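(* Let $\Bbbk$ be a field of characteristic zero and let $\mathcal{P}$ be a (weight graded, connected) symmetric operad in $\Bbbk$-vector spaces. The following are equivalent: (i) a PBW theorem holds for the modules of Kähler differentials of $\mathcal{P}$-algebras, i.e. there exists a Schur functor $\mathcal{Z}$ such that for every $\mathcal{P}$-algebra $L$ the underlying vector space of $\Omega^1_{\mathcal{P}}(L)$ is isomorphic to the evaluation $\mathcal{Z}\circ_{\mathbb{I}}L$, naturally with respect to $\mathcal{P}$-algebra morphisms; (ii) the right $\mathcal{P}$-module $\Omega^1_{\mathcal{P}}$ is free. Moreover, in this case the Schur functor $\mathcal{Z}$ that freely generates the right $\mathcal{P}$-module $\Omega^1_{\mathcal{P}}$ satisfies $$\Omega^1_{\mathcal{P}}(L)\cong\mathcal{Z}\circ_{\mathbb{I}}L$$ naturally with respect to $\mathcal{P}$-algebra morphisms.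
   Context: Schur functors are identified with symmetric sequences (linear species) $\mathcal{Z}$; $\mathcal{Z}\circ_{\mathbb{I}}V=\bigoplus_{n\ge0}\mathcal{Z}(n)\otimes_{\Bbbk S_n}V^{\otimes n}$ is the evaluation of $\mathcal{Z}$ on a vector space $V$. $\circ$ denotes composition of symmetric sequences, and $\mathbb{I}$ is the trivial operad (linear span of the unit). A right $\mathcal{P}$-module is free, generated by $\mathcal{Z}$, if it is isomorphic to $\mathcal{Z}\circ\mathcal{P}$. Connected weight graded means that $\mathcal P$ has a nonnegative weight grading compatible with the operad structure whose weight zero part is $\mathbb{I}$. For a $\mathcal{P}$-algebra $L$, the module of Kähler differentials $\Omega^1_{\mathcal{P}}(L)$ is the $L$-module (left module over the universal multiplicative enveloping algebra of $L$) representing the functor $E\mapsto\mathrm{Der}(L,E)$ of derivations of $L$ with values in $L$-modules $E$. Explicitly it is spanned by formal expressions $p(a_1,\ldots,da_i,\ldots,a_m)$ with $p\in\mathcal{P}(m)$, $a_1,\dots,a_m\in L$ (multilinear, and compatible with the symmetric group actions), modulo $$p(a_1,\ldots,q(a_i,\ldots,a_{i+n-1}),\ldots,da_j,\ldots,a_{m+n-1})=(p\circ_iq)(a_1,\ldots,a_i,\ldots,a_{i+n-1},\ldots,da_j,\ldots,a_{m+n-1}),$$ $$p(a_1,\ldots,dq(a_i,\ldots,a_{i+n-1}),\ldots,a_{m+n-1})=\sum_{j=i}^{i+n-1}(p\circ_iq)(a_1,\ldots,a_i,\ldots,da_j,\ldots,a_{i+n-1},\ldots,a_{m+n-1}).$$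 The universal right $\mathcal{P}$-module of Kähler differentials $\Omega^1_{\mathcal{P}}$ is the symmetric sequence for which $\Omega^1_{\mathcal{P}}(I)=\mathcal{P}(I)\otimes\Bbbk^I$ is spanned by pairs $(p,i)$, $p\in\mathcal{P}(I)$, $i\in I$ (the element $p$ with $d$ applied at the input $i$), with the right action of $q\in\mathcal{P}(J)$ given by $(p,i)\circ_jq=(p\circ_jq,i)$ for $j\neq i$ and $(p,i)\circ_iq=\sum_{k\in J}(p\circ_iq,k)$. It satisfies $\Omega^1_{\mathcal{P}}(L)\cong\Omega^1_{\mathcal{P}}\circ_{\mathcal{P}}L$ (relative composite product, with $L$ regarded as a symmetric sequence concentrated in arity zero) for every $\mathcal{P}$-algebra $L$. *)

(* Defs.v *)
From HB Require Import structures.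
From mathcomp Require Import all_boot all_algebra.
From mathcomp Require Import boolp.

Set Implicit Arguments.
Unset Strict Implicit.
Unset Printing Implicit Defensive.

Import GRing.Theory.
Local Open Scope ring_scope.
Local Open Scope quotient_scope.

(* The vector space [pres R] presented by generators [X] and relations [R]:
   formal linear combinations modulo the congruence generated by the vector
   space axioms and [R].  [pgen], [pgen_rel], [plift] and [pres_ext] give its
   universal property. *)
Section Presentation.
Variables (k : fieldType) (X : Type).

Inductive term : Type :=
| Tgen of X
| Tzero
| Tadd of term & term
| Tscale of k & term.

HB.instance Definition _ := gen_eqMixin term.
HB.instance Definition _ := gen_choiceMixin term.

Variable R : term -> term -> Prop.

Inductive pres_eq : term -> term -> Prop :=
| PE_rel s t : R s t -> pres_eq s t
| PE_refl s : pres_eq s s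
| PE_sym s t : pres_eq s t -> pres_eq t s
| PE_trans s t u : pres_eq s t -> pres_eq t u -> pres_eq s u
| PE_add s s' t t' : pres_eq s s' -> pres_eq t t' ->
    pres_eq (Tadd s t) (Tadd s' t')
| PE_scale c t t' : pres_eq t t' -> pres_eq (Tscale c t) (Tscale c t')
| PE_addA s t u : pres_eq (Tadd s (Tadd t u)) (Tadd (Tadd s t) u)
| PE_addC s t : pres_eq (Tadd s t) (Tadd t s)
| PE_add0 t : pres_eq (Tadd Tzero t) t
| PE_addN t : pres_eq (Tadd (Tscale (-1) t) t) Tzero
| PE_scaleA a b t : pres_eq (Tscale a (Tscale b t)) (Tscale (a * b) t)
| PE_scale1 t : pres_eq (Tscale 1 t) t
| PE_scaleDr c s t :
    pres_eq (Tscale c (Tadd s t)) (Tadd (Tscale c s) (Tscale c t))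
| PE_scaleDl a b t :
    pres_eq (Tscale (a + b) t) (Tadd (Tscale a t) (Tscale b t)).

Definition pres_eqb : rel term := fun s t => `[< pres_eq s t >].

Lemma pres_eqb_refl : reflexive pres_eqb.
Proof. by move=> s; apply/asboolP; apply: PE_refl. Qed.

Lemma pres_eqb_sym : symmetric pres_eqb.
Proof. by move=> s t; apply/asboolP/asboolP; apply: PE_sym. Qed.

Lemma pres_eqb_trans : transitive pres_eqb.
Proof.
by move=> t s u /asboolP st /asboolP tu; apply/asboolP; apply: PE_trans st tu.
Qed.

Definition pres_equiv := EquivRel pres_eqb pres_eqb_refl pres_eqb_sym
                                  pres_eqb_trans.

Definition pres : Type := {eq_quot pres_equiv}.

HB.instance Definition _ := Choice.on pres.

Definition pcl (t : term) : pres := \pi_({eq_quot pres_equiv}) t.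
Definition prep (u : pres) : term := repr (u : {eq_quot pres_equiv}).

Lemma prepK u : pcl (prep u) = u.
Proof. exact: reprK. Qed.

Lemma pclP s t : pcl s = pcl t <-> pres_eq s t.
Proof.
split=> [/eqP|st]; first by rewrite /pcl piE => /asboolP.
by apply/eqP; rewrite /pcl piE; apply/asboolP.
Qed.

Lemma prep_eq t : pres_eq (prep (pcl t)) t.
Proof. by apply/pclP; rewrite prepK. Qed.

Definition pres_add (u v : pres) : pres := pcl (Tadd (prep u) (prep v)).
Definition pres_scale (c : k) (u : pres) : pres := pcl (Tscale c (prep u)).
Definition pres_zero : pres := pcl Tzero.
Definition pres_opp (u : pres) : pres := pres_scale (-1) u.

Lemma pres_addE s t : pres_add (pcl s) (pcl t) = pcl (Tadd s t).
Proof. by apply/pclP; apply: PE_add; apply: prep_eq. Qed.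

Lemma pres_scaleE c t : pres_scale c (pcl t) = pcl (Tscale c t).
Proof. by apply/pclP; apply: PE_scale; apply: prep_eq. Qed.

Lemma pres_addA : associative pres_add.
Proof.
move=> u v w; rewrite -(prepK u) -(prepK v) -(prepK w) !pres_addE.
by apply/pclP/PE_addA.
Qed.

Lemma pres_addC : commutative pres_add.
Proof.
by move=> u v; rewrite -(prepK u) -(prepK v) !pres_addE; apply/pclP/PE_addC.
Qed.

Lemma pres_add0 : left_id pres_zero pres_add.
Proof. by move=> u; rewrite -(prepK u) pres_addE; apply/pclP/PE_add0. Qed.

Lemma pres_addN : left_inverse pres_zero pres_opp pres_add.
Proof.
move=> u; rewrite -(prepK u) /pres_opp pres_scaleE pres_addE.
exact/pclP/PE_addN.
Qed.

HB.instance Definition _ :=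
  GRing.isZmodule.Build pres pres_addA pres_addC pres_add0 pres_addN.

Lemma pres_scaleA a b u : pres_scale a (pres_scale b u) = pres_scale (a * b) u.
Proof. by rewrite -(prepK u) !pres_scaleE; apply/pclP/PE_scaleA. Qed.

Lemma pres_scale1 : left_id 1 pres_scale.
Proof. by move=> u; rewrite -(prepK u) !pres_scaleE; apply/pclP/PE_scale1. Qed.

Lemma pres_scaleDr : right_distributive pres_scale +%R.
Proof.
move=> c u v; rewrite -(prepK u) -(prepK v) [pcl _ + pcl _]pres_addE.
rewrite !pres_scaleE [RHS]pres_addE; exact/pclP/PE_scaleDr.
Qed.

Lemma pres_scaleDl u : {morph pres_scale^~ u : a b / a + b}.
Proof.
move=> a b; rewrite -(prepK u) !pres_scaleE [RHS]pres_addE.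
exact/pclP/PE_scaleDl.
Qed.

HB.instance Definition _ :=
  GRing.Zmodule_isLmodule.Build k pres pres_scaleA pres_scale1 pres_scaleDr
    pres_scaleDl.

Definition pgen (x : X) : pres := pcl (Tgen x).

Fixpoint teval (V : lmodType k) (g : X -> V) (t : term) : V :=
  match t with
  | Tgen x => g x
  | Tzero => 0
  | Tadd s t => teval g s + teval g t
  | Tscale c t => c *: teval g t
  end.

Lemma pcl_teval t : pcl t = teval pgen t.
Proof.
by elim: t => [x||s IHs t IHt|c t IHt] //=;
  rewrite -?IHs -?IHt [RHS](pres_addE, pres_scaleE).
Qed.

Lemma pgen_rel s t : R s t -> teval pgen s = teval pgen t.
Proof. by move=> st; rewrite -!pcl_teval; apply/pclP/PE_rel. Qed.

Lemma pres_ind (Q : pres -> Prop) :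
    (forall x, Q (pgen x)) -> Q 0 -> (forall u v, Q u -> Q v -> Q (u + v)) ->
  (forall c u, Q u -> Q (c *: u)) -> forall u, Q u.
Proof.
move=> Qg Q0 Qa Qs u; rewrite -(prepK u) pcl_teval.
by elim: (prep u) => /=; auto.
Qed.

Section Lift.
Variables (V : lmodType k) (g : X -> V).
Hypothesis gR : forall s t, R s t -> teval g s = teval g t.

Lemma teval_pres_eq s t : pres_eq s t -> teval g s = teval g t.
Proof using gR.
elim=> //=; intros; rewrite ?scaleN1r ?addNr ?add0r ?scalerA ?scale1r
  ?scalerDr ?scalerDl ?addrA //; by [congruence | exact: addrC | exact: gR].
Qed.

Definition plift_fun (u : pres) : V := teval g (prep u).

Lemma plift_fun_cl t : plift_fun (pcl t) = teval g t.
Proof using gR. exact/teval_pres_eq/prep_eq. Qed.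

Lemma plift_fun_linear : linear plift_fun.
Proof using gR.
move=> c u v; rewrite -(prepK u) -(prepK v).
rewrite [_ *: _]pres_scaleE [pcl _ + pcl _]pres_addE.
by rewrite !plift_fun_cl.
Qed.

Definition plift : {linear pres -> V} :=
  HB.pack plift_fun (GRing.isLinear.Build k pres V *:%R plift_fun
                       plift_fun_linear).

Lemma plift_gen x : plift (pgen x) = g x.
Proof. exact: plift_fun_cl. Qed.

End Lift.
End Presentation.
Arguments plift : simpl never.

Lemma pres_ext (k : fieldType) (X : Type) (R : term k X -> term k X -> Prop)
    (V : lmodType k) (f g : {linear pres R -> V}) :
  (forall x, f (pgen R x) = g (pgen R x)) -> f =1 g.
Proof.
move=> fg; elim/pres_ind=> [x||u v IHu IHv|c u IHu] //.
- by rewrite !linear0.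
- by rewrite !linearD IHu IHv.
- by rewrite !linearZ /= IHu.
Qed.

Record bij (I J : Type) := Bij {
  bij_fun :> I -> J;
  bij_inv : J -> I;
  bijK : cancel bij_fun bij_inv;
  bijVK : cancel bij_inv bij_fun }.

Lemma bij_eq (I J : Type) (s t : bij I J) : s =1 t -> s = t.
Proof.
move=> /funext; case: s t => [f g fK gK] [f' g' fK' gK'] /= e.
subst f'; have e : g = g' by apply: funext => x; rewrite -[RHS]fK gK'.
by subst g'; congr Bij; apply: Prop_irrelevance.
Qed.

Lemma bij_inj (I J : Type) (s : bij I J) : injective s.
Proof. exact: can_inj (@bijK _ _ s). Qed.

Definition bij_id (I : Type) : bij I I :=
  @Bij I I id id (fun=> erefl) (fun=> erefl).

Definition bij_comp (I J K : Type) (t : bij J K) (s : bij I J) : bij I K :=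
  Bij (can_comp (@bijK _ _ t) (@bijK _ _ s))
      (can_comp (@bijVK _ _ s) (@bijVK _ _ t)).

Definition bij_sym (I J : Type) (s : bij I J) : bij J I :=
  Bij (@bijVK _ _ s) (@bijK _ _ s).

(* [tot J] is the disjoint union of the finite sets [J i]. *)
Definition tot (I : finType) (J : I -> finType) : finType := {i : I & J i}.

Definition pt (I : finType) (J : I -> finType) (i : I) (j : J i) : tot J :=
  existT _ i j.

Section TotBij.
Variables (I I' : finType) (J : I -> finType) (J' : I' -> finType).
Variables (s : bij I I') (t : forall i, bij (J i) (J' (s i))).

Definition tot_fun (x : tot J) : tot J' :=
  let: existT i j := x in pt (t i j).

Definition tot_inv (y : tot J') : tot J :=
  let: existT i' j' := y in
  pt (bij_inv (t (bij_inv s i'))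
        (ecast z (J' z) (esym (bijVK s i')) j')).

Lemma tot_funK : cancel tot_fun tot_inv.
Proof.
case=> i j; rewrite /tot_fun /tot_inv /pt.
move: (esym _); rewrite bijK => e.
by rewrite (eq_axiomK e) /= bijK.
Qed.

Lemma tot_invK : cancel tot_inv tot_fun.
Proof.
case=> i' j'; rewrite /tot_fun /tot_inv /= (bijVK (t _)).
by case: _ / (esym _).
Qed.

Definition tot_bij : bij (tot J) (tot J') := Bij tot_funK tot_invK.
End TotBij.

Section AssocBij.
Variables (I : finType) (J : I -> finType) (K : tot J -> finType).

Definition tot2 : finType := tot (fun i => tot (fun j : J i => K (pt j))).

Definition assoc_fun (x : tot K) : tot2 :=
  let: existT y z := x in
  (let: existT i j as y0 := y return K y0 -> tot2 in
   fun z0 => @pt I (fun i => tot (fun j : J i => K (pt j))) i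
               (@pt (J i) (fun j => K (pt j)) j z0)) z.

Definition assoc_inv (x : tot2) : tot K :=
  let: existT i y := x in let: existT j z := y in @pt _ K (pt j) z.

Lemma assoc_funK : cancel assoc_fun assoc_inv.
Proof. by case=> -[i j] z. Qed.

Lemma assoc_invK : cancel assoc_inv assoc_fun.
Proof. by case=> i [j z]. Qed.

Definition assoc_bij : bij (tot K) tot2 := Bij assoc_funK assoc_invK.
End AssocBij.

Section UnitBij.
Variable J : finType.

Definition unitl_fun (x : @tot unit (fun=> J)) : J := let: existT _ j := x in j.
Definition unitr_fun (x : @tot J (fun=> unit)) : J := let: existT j _ := x in j.

Lemma unitl_funK : cancel unitl_fun (@pt unit (fun=> J) tt).
Proof. by case=> -[] j. Qed.

Lemma unitr_funK : cancel unitr_fun (fun j => @pt J (fun=> unit) j tt).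
Proof. by case=> j []. Qed.

Definition unitl_bij : bij (@tot unit (fun=> J)) J :=
  Bij unitl_funK (fun=> erefl).

Definition unitr_bij : bij (@tot J (fun=> unit)) J :=
  Bij unitr_funK (fun=> erefl).
End UnitBij.

Section SubBij.
Variables (T T' : Type) (h : bij T T') (A : pred T) (B : pred T').
Hypothesis AB : forall t, B (h t) = A t.

Definition sub_fun (x : {t | A t}) : {t | B t} :=
  exist _ (h (sval x)) (etrans (AB (sval x)) (proj2_sig x)).

Lemma sub_inv_subproof (y : {t | B t}) : A (bij_inv h (sval y)).
Proof. by rewrite -AB bijVK (proj2_sig y). Qed.

Definition sub_inv (y : {t | B t}) : {t | A t} :=
  exist _ (bij_inv h (sval y)) (sub_inv_subproof y).

Lemma sub_funK : cancel sub_fun sub_inv.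
Proof. by move=> x; apply: val_inj; rewrite /= bijK. Qed.

Lemma sub_invK : cancel sub_inv sub_fun.
Proof. by move=> x; apply: val_inj; rewrite /= bijVK. Qed.

Definition sub_bij : bij {t | A t} {t | B t} := Bij sub_funK sub_invK.
End SubBij.

Definition fib (T T' : finType) (f : T -> T') (j : T') : finType :=
  {t : T | f t == j}.

Section FibTot.
Variables (T T' : finType) (f : T -> T') (J : T -> finType) (j : T').

Local Notation L := (tot (fun t : fib f j => J (sval t))).
Local Notation M := (fib (fun x : tot J => f (tag x)) j).

Definition fib_tot_fun (x : L) : M :=
  let: existT t y := x in exist _ (@pt T J (sval t) y) (proj2_sig t).

Definition fib_tot_inv (x : M) : L :=
  @pt (fib f j) (fun t => J (sval t)) (exist _ (tag (sval x)) (proj2_sig x))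
      (tagged (sval x)).

Lemma fib_tot_funK : cancel fib_tot_fun fib_tot_inv.
Proof. by case=> -[t ft] y. Qed.

Lemma fib_tot_invK : cancel fib_tot_inv fib_tot_fun.
Proof. by case=> -[t y] ft. Qed.

Definition fib_tot_bij : bij L M := Bij fib_tot_funK fib_tot_invK.
End FibTot.

(* [graft J i] is (I \ {i}) |_| J, the set of inputs of p \circ_i q for p with
   inputs I and q with inputs J.  [gfam] presents it as the disjoint union over
   x in I of J (for x = i) or a point (for x <> i). *)
Definition graft (I J : finType) (i : I) : finType :=
  ({x : I | x != i} + J)%type.

Section GraftBij.
Variables (I J : finType) (i : I).

Definition gfam (x : I) : finType := if x == i then J else unit.

Definition graft_case (x : I) b (e : (x == i) = b) :
    (if b then J else unit : finType) -> graft J i :=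
  match b return (x == i) = b -> (if b then J else unit : finType) ->
                 graft J i with
  | true => fun _ y => inr y
  | false => fun e _ => inl (exist _ x (negbT e))
  end e.

Definition graft_fun (x : tot gfam) : graft J i :=
  let: existT x y := x in @graft_case x _ erefl y.

Definition gfam_cast (x : I) b (e : (x == i) = b)
    (y : if b then J else unit : finType) : gfam x :=
  ecast b (if b then J else unit : finType) (esym e) y.

Definition graft_inv (x : graft J i) : tot gfam :=
  match x with
  | inl x => @pt I gfam (sval x)
               (@gfam_cast (sval x) _ (negbTE (proj2_sig x)) tt)
  | inr y => @pt I gfam i (@gfam_cast i _ (eqxx i) y)
  end.

Lemma graft_fun_cast x b (e : (x == i) = b) y :
  graft_fun (pt (gfam_cast e y)) = graft_case e y.
Proof. by case: _ / e y. Qed.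

Lemma graft_inv_case x b (e : (x == i) = b) y :
  graft_inv (graft_case e y) = pt (gfam_cast e y).
Proof.
case: b e y => e y /=; last by case: y; rewrite (eq_irrelevance (negbTE _) e).
by move: (e); rewrite (eqP e) => e'; rewrite (eq_irrelevance (eqxx i) e').
Qed.

Lemma graft_funK : cancel graft_fun graft_inv.
Proof. by case=> x y; apply: graft_inv_case. Qed.

Lemma graft_invK : cancel graft_inv graft_fun.
Proof.
by case=> [[x nx]|y]; rewrite /graft_inv graft_fun_cast //=;
  congr inl; apply: val_inj.
Qed.

Definition graft_bij : bij (tot gfam) (graft J i) := Bij graft_funK graft_invK.
End GraftBij.

Definition fib_bij (A A' T T' : finType) (f : T -> A) (f' : T' -> A')
    (h : bij T T') (j : A) (j' : A')
    (H : forall t, (f' (h t) == j') = (f t == j)) : bij (fib f j) (fib f' j') :=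
  sub_bij H.

(* The additivity/homogeneity in the i-th argument is stated on families
   agreeing away from i, as [E] is dependent. *)
Definition multilinear (k : fieldType) (I : finType) (E : I -> lmodType k)
    (F : lmodType k) (g : (forall i, E i) -> F) : Prop :=
  forall (i : I) (c : k) (u v w : forall x, E x),
    w i = c *: u i + v i ->
    (forall x, x != i -> u x = w x /\ v x = w x) ->
  g w = c *: g u + g v.

(* Symmetric sequences are taken as linear species, i.e. functors from finite
   sets and bijections to vector spaces; Z(n) is [Z 'I_n]. *)
Record species (k : fieldType) := Species {
  sp_obj :> finType -> lmodType k;
  sp_map : forall I J : finType, bij I J -> {linear sp_obj I -> sp_obj J};
  sp_map_id : forall (I : finType) (p : sp_obj I), sp_map (bij_id I) p = p;
  sp_map_comp : forall (I J K : finType) (t : bij J K) (s : bij I J)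
      (p : sp_obj I),
    sp_map (bij_comp t s) p = sp_map t (sp_map s p) }.

(* Operads are given by the total composition
   P(I) (x) (x)_i P(J_i) -> P(|_|_i J_i); the partial compositions
   p \circ_i q = p(id, .., q, .., id) are [pcomp]. *)
Record operad (k : fieldType) := Operad {
  op_sp :> species k;
  op_id : op_sp unit;
  op_comp : forall (I : finType) (J : I -> finType),
    op_sp I -> (forall i, op_sp (J i)) -> op_sp (tot J);
  op_comp_linear : forall (I : finType) (J : I -> finType)
      (q : forall i, op_sp (J i)),
    linear (fun p : op_sp I => op_comp p q);
  op_comp_multilinear : forall (I : finType) (J : I -> finType) (p : op_sp I),
    multilinear (fun q : forall i, op_sp (J i) => op_comp p q);
  op_comp_natural : forall (I I' : finType) (J : I -> finType)
      (J' : I' -> finType) (s : bij I I') (t : forall i, bij (J i) (J' (s i)))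
      (p : op_sp I) (q : forall i, op_sp (J i)) (q' : forall i, op_sp (J' i)),
    (forall i, q' (s i) = sp_map op_sp (t i) (q i)) ->
    sp_map op_sp (tot_bij t) (op_comp p q) = op_comp (sp_map op_sp s p) q';
  op_compA : forall (I : finType) (J : I -> finType) (K : tot J -> finType)
      (p : op_sp I) (q : forall i, op_sp (J i)) (r : forall x, op_sp (K x)),
    sp_map op_sp (assoc_bij K) (op_comp (op_comp p q) r) =
    op_comp p (fun i => op_comp (q i) (fun j => r (pt j)));
  op_comp1l : forall (J : finType) (q : op_sp J),
    sp_map op_sp (unitl_bij J) (op_comp op_id (fun=> q)) = q;
  op_comp1r : forall (I : finType) (p : op_sp I),
    sp_map op_sp (unitr_bij I) (op_comp p (fun=> op_id)) = p }.

Definition gop (k : fieldType) (P : operad k) (I J : finType) (i : I) (q : P J)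
    (x : I) : P (gfam J i x) :=
  match x == i as b return P (if b then J else unit : finType) with
  | true => q
  | false => op_id P
  end.

Definition pcomp (k : fieldType) (P : operad k) (I J : finType) (p : P I)
    (i : I) (q : P J) : P (graft J i) :=
  sp_map P (graft_bij J i) (op_comp p (gop i q)).

(* [wt w p] states that p is homogeneous of weight w; [wt_span] and [wt_direct]
   say that each P(I) is the direct sum of its homogeneous components.
   [wt_connected] and [wt_id_neq0] identify the weight zero part with the
   trivial operad: it vanishes on I unless I has one element, where it is the
   line spanned by the (relabelled) unit. *)
Record connected_weight_grading (k : fieldType) (P : operad k) :=
  ConnectedWeightGrading {
  wt : nat -> forall I : finType, P I -> Prop;
  wt0 : forall w (I : finType), wt w (0 : P I);
  wt_lin : forall w (I : finType) (c : k) (p q : P I),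
    wt w p -> wt w q -> wt w (c *: p + q);
  wt_span : forall (I : finType) (p : P I),
    exists (n : nat) (h : nat -> P I),
      (forall w, wt w (h w)) /\ p = \sum_(w < n) h w;
  wt_direct : forall (I : finType) (n : nat) (h : nat -> P I),
    (forall w, wt w (h w)) -> \sum_(w < n) h w = 0 ->
    forall w, (w < n)%N -> h w = 0;
  wt_map : forall w (I J : finType) (s : bij I J) (p : P I),
    wt w p -> wt w (sp_map P s p);
  wt_comp : forall (I : finType) (J : I -> finType) (p : P I)
      (q : forall i, P (J i)) (a : nat) (b : I -> nat),
    wt a p -> (forall i, wt (b i) (q i)) ->
    wt (a + \sum_i b i)%N (op_comp p q);
  wt_connected : forall (I : finType) (p : P I),
    wt 0 p <-> p = 0 \/ exists (c : k) (s : bij unit I),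
                          p = c *: sp_map P s (op_id P);
  wt_id_neq0 : op_id P != 0 }.

Record rmod (k : fieldType) (P : operad k) := RMod {
  rm_sp :> species k;
  rm_act : forall (I : finType) (J : I -> finType),
    rm_sp I -> (forall i, P (J i)) -> rm_sp (tot J);
  rm_act_linear : forall (I : finType) (J : I -> finType)
      (q : forall i, P (J i)),
    linear (fun m : rm_sp I => rm_act m q);
  rm_act_multilinear : forall (I : finType) (J : I -> finType) (m : rm_sp I),
    multilinear (fun q : forall i, P (J i) => rm_act m q);
  rm_act_natural : forall (I I' : finType) (J : I -> finType)
      (J' : I' -> finType) (s : bij I I') (t : forall i, bij (J i) (J' (s i)))
      (m : rm_sp I) (q : forall i, P (J i)) (q' : forall i, P (J' i)),
    (forall i, q' (s i) = sp_map P (t i) (q i)) ->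
    sp_map rm_sp (tot_bij t) (rm_act m q) = rm_act (sp_map rm_sp s m) q';
  rm_actA : forall (I : finType) (J : I -> finType) (K : tot J -> finType)
      (m : rm_sp I) (q : forall i, P (J i)) (r : forall x, P (K x)),
    sp_map rm_sp (assoc_bij K) (rm_act (rm_act m q) r) =
    rm_act m (fun i => op_comp (q i) (fun j => r (pt j)));
  rm_act1 : forall (I : finType) (m : rm_sp I),
    sp_map rm_sp (unitr_bij I) (rm_act m (fun=> op_id P)) = m }.

Definition rpcomp (k : fieldType) (P : operad k) (M : rmod P) (I J : finType)
    (m : M I) (i : I) (q : P J) : M (graft J i) :=
  sp_map M (graft_bij J i) (rm_act m (gop i q)).

Definition rmod_iso (k : fieldType) (P : operad k) (M N : rmod P) : Prop :=
  exists phi : forall I : finType, {linear M I -> N I},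
    [/\ forall I, bijective (phi I),
        forall (I J : finType) (s : bij I J) (m : M I),
          phi J (sp_map M s m) = sp_map N s (phi I m)
      & forall (I : finType) (J : I -> finType) (m : M I)
          (q : forall i, P (J i)),
          phi (tot J) (rm_act m q) = rm_act (phi I m) q].

Lemma sp_map_eq1 (k : fieldType) (P : species k) (I : finType) (s : bij I I)
  (p : P I) : s =1 id -> sp_map P s p = p.
Proof. by move=> e; rewrite (bij_eq (t := bij_id I) e) sp_map_id. Qed.

Lemma sp_map_eq (k : fieldType) (P : species k) (I J : finType) (s t : bij I J)
  (p : P I) : s =1 t -> sp_map P s p = sp_map P t p.
Proof. by move=> e; rewrite (bij_eq e). Qed.

Section UniversalKahler.
Variables (k : fieldType) (P : operad k).

(* P(I) (x) k^I is the space of functions I -> P(I), with the pair (p, i)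
   represented by [dpair p i].  [omega_rpcomp_neq] and [omega_rpcomp_eq] below
   are the formulas defining the right action on such pairs. *)
Definition omega_obj (I : finType) : lmodType k := {ffun I -> P I}.

Definition dpair (I : finType) (p : P I) (i : I) : omega_obj I :=
  [ffun x => if x == i then p else 0].

Definition omega_map_fun (I J : finType) (s : bij I J) (w : omega_obj I) :
    omega_obj J :=
  [ffun y => sp_map P s (w (bij_inv s y))].

Lemma omega_map_linear (I J : finType) (s : bij I J) :
  linear (omega_map_fun s).
Proof. by move=> c u v; apply/ffunP=> y; rewrite !ffunE linearP. Qed.

Definition omega_map (I J : finType) (s : bij I J) :
    {linear omega_obj I -> omega_obj J} :=
  HB.pack (omega_map_fun s)
    (GRing.isLinear.Build k _ _ *:%R (omega_map_fun s) (omega_map_linear s)).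

Arguments omega_map : simpl never.

Lemma omega_map_id (I : finType) (w : omega_obj I) :
  omega_map (bij_id I) w = w.
Proof. by apply/ffunP=> y; rewrite !ffunE sp_map_id. Qed.

Lemma omega_map_comp (I J K : finType) (t : bij J K) (s : bij I J)
    (w : omega_obj I) :
  omega_map (bij_comp t s) w = omega_map t (omega_map s w).
Proof. by apply/ffunP=> y; rewrite !ffunE sp_map_comp. Qed.

Definition omega_sp : species k := Species omega_map_id omega_map_comp.

Definition omega_act (I : finType) (J : I -> finType) (w : omega_sp I)
    (q : forall i, P (J i)) : omega_sp (tot J) :=
  [ffun x => op_comp ((w : omega_obj I) (tag x)) q].

Lemma omega_act_linear (I : finType) (J : I -> finType)
    (q : forall i, P (J i)) :
  linear (fun w : omega_sp I => omega_act w q).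
Proof.
by move=> c u v; apply/ffunP=> x; rewrite !ffunE op_comp_linear.
Qed.

Lemma omega_act_multilinear (I : finType) (J : I -> finType) (w : omega_sp I) :
  multilinear (fun q : forall i, P (J i) => omega_act w q).
Proof.
move=> i c u v q qi qx; apply/ffunP=> x; rewrite !ffunE.
exact: op_comp_multilinear qi qx.
Qed.

Lemma omega_act_natural (I I' : finType) (J : I -> finType)
      (J' : I' -> finType) (s : bij I I') (t : forall i, bij (J i) (J' (s i)))
      (w : omega_sp I) (q : forall i, P (J i)) (q' : forall i, P (J' i)) :
    (forall i, q' (s i) = sp_map P (t i) (q i)) ->
  sp_map omega_sp (tot_bij t) (omega_act w q) =
  omega_act (sp_map omega_sp s w) q'.
Proof.
move=> qq'; apply/ffunP=> x; rewrite !ffunE (op_comp_natural _ qq').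
by case: x => i' j'.
Qed.

Lemma omega_actA (I : finType) (J : I -> finType) (K : tot J -> finType)
      (w : omega_sp I) (q : forall i, P (J i)) (r : forall x, P (K x)) :
  sp_map omega_sp (assoc_bij K) (omega_act (omega_act w q) r) =
  omega_act w (fun i => op_comp (q i) (fun j => r (pt j))).
Proof.
apply/ffunP=> x; rewrite !ffunE op_compA.
by case: x => i [j z].
Qed.

Lemma omega_act1 (I : finType) (w : omega_sp I) :
  sp_map omega_sp (unitr_bij I) (omega_act w (fun=> op_id P)) = w.
Proof. by apply/ffunP=> x; rewrite !ffunE op_comp1r. Qed.

Definition Omega : rmod P :=
  RMod omega_act_linear omega_act_multilinear omega_act_natural omega_actA
    omega_act1.

Lemma op_comp0 (I : finType) (J : I -> finType) (q : forall i, P (J i)) :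
  op_comp (0 : P I) q = 0.
Proof.
have := op_comp_linear q 1 0 0; rewrite scaler0 addr0 scale1r.
by move/eqP; rewrite -subr_eq0 opprD addrA subrr add0r oppr_eq0 => /eqP.
Qed.

Lemma omega_act_dpair (I : finType) (J : I -> finType) (p : P I) (i : I)
    (q : forall i, P (J i)) :
  rm_act (dpair p i : Omega I) q =
  \sum_(j : J i) dpair (op_comp p q) (@pt I J i j).
Proof.
apply/ffunP=> -[i' j']; rewrite ffunE sum_ffunE ffunE /=.
case: (eqVneq i' i) => [e|ne].
  subst i'; rewrite (bigD1 j') //= ffunE eqxx big1 ?addr0 // => j nj.
  by rewrite ffunE eq_sym -tag_eqE /tag_eq eqxx /= tagged_asE (negbTE nj).
rewrite op_comp0 big1 // => j _; rewrite ffunE -tag_eqE /tag_eq /=.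
by rewrite (negbTE ne).
Qed.

Lemma omega_rpcomp_neq (I J : finType) (p : P I) (i j : I) (q : P J)
    (ij : i != j) :
  rpcomp (dpair p i : Omega I) j q = dpair (pcomp p j q) (inl (exist _ i ij)).
Proof.
apply/ffunP=> x; rewrite /rpcomp /pcomp /= !ffunE.
have -> : (x == inl (exist _ i ij)) = (tag (graft_inv x) == i).
  by case: x => [x|y] //=; rewrite [j == i]eq_sym (negbTE ij).
by case: ifP; rewrite ?op_comp0 ?linear0.
Qed.

Lemma omega_rpcomp_eq (I J : finType) (p : P I) (i : I) (q : P J) :
  rpcomp (dpair p i : Omega I) i q =
  \sum_(x : J) dpair (pcomp p i q) (inr x).
Proof.
apply/ffunP=> x; rewrite sum_ffunE /rpcomp /pcomp /= !ffunE.
case: x => [[x nx]|y] /=.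
  rewrite (negbTE nx) op_comp0 linear0 big1 // => j _.
  by rewrite ffunE.
rewrite eqxx (bigD1 y) //= ffunE eqxx big1 ?addr0 // => j nj.
rewrite ffunE; case: eqP => // -[e]; by rewrite e eqxx in nj.
Qed.

End UniversalKahler.

Section Composite.
Variables (k : fieldType) (Z : species k) (P : operad k).

(* (Z o P)(T) is the sum over n of
   Z(n) (x)_{S_n} (+)_{f : T -> [n]} (x)_j P(f^-1(j)). *)
Inductive comp_gen (T : finType) : Type :=
  CGen (n : nat) (z : Z 'I_n) (f : T -> 'I_n) (p : forall j, P (fib f j)).

Lemma fib_perm_subproof (T : finType) (n : nat) (s : bij 'I_n 'I_n)
    (f : T -> 'I_n) (j : 'I_n) (t : T) : (s (f t) == s j) = (f t == j).
Proof. exact/inj_eq/bij_inj. Qed.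

Definition fib_perm (T : finType) (n : nat) (s : bij 'I_n 'I_n)
    (f : T -> 'I_n) (j : 'I_n) : bij (fib f j) (fib (fun t => s (f t)) (s j)) :=
  fib_bij (h := bij_id T) (fib_perm_subproof s f j).

Inductive comp_rel (T : finType) :
    term k (comp_gen T) -> term k (comp_gen T) -> Prop :=
| CR_linear n (c : k) (z z' : Z 'I_n) (f : T -> 'I_n)
    (p : forall j, P (fib f j)) :
    comp_rel (Tgen _ (CGen (c *: z + z') p))
             (Tadd (Tscale c (Tgen _ (CGen z p))) (Tgen _ (CGen z' p)))
| CR_multilinear n (z : Z 'I_n) (f : T -> 'I_n) (j : 'I_n) (c : k)
    (u v p : forall j, P (fib f j)) :
    p j = c *: u j + v j -> (forall x, x != j -> u x = p x /\ v x = p x) ->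
    comp_rel (Tgen _ (CGen z p))
             (Tadd (Tscale c (Tgen _ (CGen z u))) (Tgen _ (CGen z v)))
| CR_equivariant n (s : bij 'I_n 'I_n) (z : Z 'I_n) (f : T -> 'I_n)
    (p : forall j, P (fib f j)) (p' : forall j, P (fib (fun t => s (f t)) j)) :
    (forall j, p' (s j) = sp_map P (fib_perm s f j) (p j)) ->
    comp_rel (Tgen _ (CGen (sp_map Z s z) p')) (Tgen _ (CGen z p)).

Definition comp_obj (T : finType) : lmodType k := pres (@comp_rel T).

Definition cgen (T : finType) n (z : Z 'I_n) (f : T -> 'I_n)
    (p : forall j, P (fib f j)) : comp_obj T := pgen _ (CGen z p).

Lemma CGen_eq (T : finType) n (z : Z 'I_n) (f f' : T -> 'I_n)
    (p : forall j, P (fib f j)) (p' : forall j, P (fib f' j)) :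
    f =1 f' ->
    (forall j (e : bij (fib f j) (fib f' j)),
       (forall t, sval (e t) = sval t) -> p' j = sp_map P e (p j)) ->
  CGen z p = CGen z p'.
Proof.
move=> /funext ff'; subst f' => pp'; suff -> : p = p' by [].
by apply: functional_extensionality_dep => j;
  rewrite (pp' j (bij_id _)) ?sp_map_id.
Qed.

Lemma comp_ext (T : finType) (V : lmodType k) (f g : {linear comp_obj T -> V}) :
    (forall n (z : Z 'I_n) (h : T -> 'I_n) (p : forall j, P (fib h j)),
       f (cgen z p) = g (cgen z p)) ->
  f =1 g.
Proof. by move=> fg; apply: pres_ext => -[n z h p]; apply: fg. Qed.

Lemma fib_relabel_subproof (T T' : finType) (h : bij T T') n (f : T -> 'I_n)
    (j : 'I_n) (t : T) : (f (bij_inv h (h t)) == j) = (f t == j).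
Proof. by rewrite bijK. Qed.

Definition fib_relabel (T T' : finType) (h : bij T T') n (f : T -> 'I_n)
    (j : 'I_n) : bij (fib f j) (fib (fun t => f (bij_inv h t)) j) :=
  fib_bij (fib_relabel_subproof h f j).

Definition comp_map_gen (T T' : finType) (h : bij T T') (x : comp_gen T) :
    comp_obj T' :=
  let: CGen n z f p := x in
  cgen z (fun j => sp_map P (fib_relabel h f j) (p j)).

Lemma comp_map_subproof (T T' : finType) (h : bij T T') s t :
  comp_rel s t -> teval (comp_map_gen h) s = teval (comp_map_gen h) t.
Proof.
case=> {s t} /=.
- by move=> n c z z' f p; apply: (pgen_rel (CR_linear _ _ _ _)).
- move=> n z f j c u v p pj px.
  apply: (pgen_rel (CR_multilinear (j := j) _ _ _)) => [|x xj].
    by rewrite pj linearP.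
  by have [-> ->] := px x xj.
- move=> n s z f p p' pp'.
  apply: (pgen_rel (CR_equivariant _ _)) => j.
  rewrite pp' -!sp_map_comp; apply: sp_map_eq => t; exact: val_inj.
Qed.

Definition comp_map (T T' : finType) (h : bij T T') :
    {linear comp_obj T -> comp_obj T'} := plift (@comp_map_subproof T T' h).

Arguments comp_map : simpl never.

Lemma comp_mapE (T T' : finType) (h : bij T T') n (z : Z 'I_n) (f : T -> 'I_n)
    (p : forall j, P (fib f j)) :
  comp_map h (cgen z p) = cgen z (fun j => sp_map P (fib_relabel h f j) (p j)).
Proof. exact: (plift_gen (@comp_map_subproof T T' h)). Qed.

Lemma comp_map_id (T : finType) (u : comp_obj T) : comp_map (bij_id T) u = u.
Proof.
apply: (comp_ext (f := comp_map (bij_id T)) (g := idfun)) => n z f p.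
rewrite comp_mapE; congr pgen; apply: CGen_eq => // j e ve.
by rewrite -sp_map_comp sp_map_eq1 // => t; apply: val_inj; rewrite /= ve.
Qed.

Lemma comp_map_comp (T T' T'' : finType) (g : bij T' T'') (h : bij T T')
    (u : comp_obj T) : comp_map (bij_comp g h) u = comp_map g (comp_map h u).
Proof.
apply: (comp_ext (f := comp_map (bij_comp g h))
  (g := comp_map g \o comp_map h)) => n z f p.
rewrite -[RHS]/(comp_map g (comp_map h _)).
rewrite !comp_mapE; congr pgen; apply: CGen_eq => // j e ve.
rewrite -!sp_map_comp; apply: sp_map_eq => t; apply: val_inj.
by rewrite /= ve.
Qed.

Definition comp_sp : species k := Species comp_map_id comp_map_comp.

Section Act.
Variables (T : finType) (J : T -> finType) (q : forall t, P (J t)).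

Definition comp_act_gen (x : comp_gen T) : comp_obj (tot J) :=
  let: CGen n z f p := x in
  cgen z (fun j => sp_map P (fib_tot_bij f J j)
                     (op_comp (p j) (fun t => q (sval t)))).

Lemma comp_act_subproof s t :
  comp_rel s t -> teval comp_act_gen s = teval comp_act_gen t.
Proof.
case=> {s t} /=.
- by move=> n c z z' f p; apply: (pgen_rel (CR_linear _ _ _ _)).
- move=> n z f j c u v p pj px.
  apply: (pgen_rel (CR_multilinear (j := j) _ _ _)) => [|x xj].
    by rewrite pj op_comp_linear linearP.
  by have [-> ->] := px x xj.
- move=> n s z f p p' pp'.
  apply: (pgen_rel (CR_equivariant _ _)) => j.
  rewrite pp' -(op_comp_natural (t := fun t => bij_id (J (sval t))) _
    (q := fun t => q (sval t))); last by move=> t; rewrite sp_map_id.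
  by rewrite -!sp_map_comp; apply: sp_map_eq => -[[t ft] y]; apply: val_inj.
Qed.

Definition comp_act_lin : {linear comp_obj T -> comp_obj (tot J)} :=
  plift comp_act_subproof.
Arguments comp_act_lin : simpl never.
End Act.

Definition comp_act (T : finType) (J : T -> finType) (u : comp_sp T)
    (q : forall t, P (J t)) : comp_sp (tot J) := comp_act_lin q u.

Lemma comp_actE (T : finType) (J : T -> finType) n (z : Z 'I_n) (f : T -> 'I_n)
    (p : forall j, P (fib f j)) (q : forall t, P (J t)) :
  comp_act (cgen z p) q =
  cgen z (fun j => sp_map P (fib_tot_bij f J j)
                     (op_comp (p j) (fun t => q (sval t)))).
Proof. exact: (plift_gen (comp_act_subproof q)). Qed.

Lemma comp_act_linear (T : finType) (J : T -> finType)
    (q : forall t, P (J t)) :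
  linear (fun u : comp_sp T => comp_act u q).
Proof. by move=> c u v; rewrite /comp_act linearP. Qed.

Lemma comp_act_multilinear (T : finType) (J : T -> finType) (m : comp_sp T) :
  multilinear (fun q : forall t, P (J t) => comp_act m q).
Proof.
move=> t c u v w wt wx.
elim/pres_ind: m => [[n z f p]||m m' IHm IHm'|a m IHm].
- rewrite -[pgen _ _]/(cgen z p) !comp_actE.
  apply: (pgen_rel (CR_multilinear (j := f t) _ _ _)) => [|x xj].
    rewrite -linearP; congr (sp_map _ _ _).
    apply: (@op_comp_multilinear _ P _ _ _ (exist _ t (eqxx (f t)))) => //.
    by move=> [t' ft'] /= nt; apply: wx; apply: contraNN nt => /eqP e;
      apply/eqP/val_inj.
  have E y : y \in [:: u; v] ->
      (fun t0 : fib f x => y (sval t0)) = (fun t0 => w (sval t0)).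
    rewrite !inE => yuv; apply: functional_extensionality_dep => -[t' /= ft'].
    have /wx[ut vt] : t' != t by apply: contraNN xj => /eqP <-; rewrite eq_sym.
    by case/orP: yuv => /eqP ->.
  by rewrite !E ?inE ?eqxx ?orbT.
- have E y : comp_act (0 : comp_sp T) y = 0 := linear0 (comp_act_lin y).
  by rewrite !E scaler0 addr0.
- have E y : comp_act (m + m' : comp_sp T) y = comp_act m y + comp_act m' y :=
    linearD (comp_act_lin y) m m'.
  by rewrite !E IHm IHm' scalerDr addrACA.
- have E y : comp_act (a *: m : comp_sp T) y = a *: comp_act m y :=
    linearZ_LR (comp_act_lin y) a m.
  by rewrite !E IHm scalerDr !scalerA mulrC.
Qed.

Lemma comp_act_natural (T T' : finType) (J : T -> finType)
      (J' : T' -> finType) (s : bij T T') (h : forall t, bij (J t) (J' (s t)))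
      (m : comp_sp T) (q : forall t, P (J t)) (q' : forall t, P (J' t)) :
    (forall t, q' (s t) = sp_map P (h t) (q t)) ->
  sp_map comp_sp (tot_bij h) (comp_act m q) =
  comp_act (sp_map comp_sp s m) q'.
Proof.
move=> qq'.
apply: (comp_ext (f := comp_map (tot_bij h) \o comp_act_lin q)
  (g := comp_act_lin q' \o comp_map s)) => n z f p.
rewrite -[LHS]/(comp_map (tot_bij h) (comp_act (cgen z p) q)).
rewrite -[RHS]/(comp_act (comp_map s (cgen z p)) q').
rewrite comp_actE !comp_mapE comp_actE.
congr pgen; apply: CGen_eq => [[t' y']|j e ve] //=.
rewrite -(op_comp_natural (s := fib_relabel s f j)
  (t := fun t => h (sval t)) _ (q := fun t => q (sval t))); last first.
  by move=> t /=; rewrite qq'.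
rewrite -!sp_map_comp; apply: sp_map_eq => -[[t ft] y]; apply: val_inj.
by rewrite /= ve.
Qed.

Lemma comp_actA (T : finType) (J : T -> finType) (K : tot J -> finType)
      (m : comp_sp T) (q : forall t, P (J t)) (r : forall x, P (K x)) :
  sp_map comp_sp (assoc_bij K) (comp_act (comp_act m q) r) =
  comp_act m (fun t => op_comp (q t) (fun j => r (pt j))).
Proof.
apply: (comp_ext
  (f := comp_map (assoc_bij K) \o comp_act_lin r \o comp_act_lin q)
  (g := comp_act_lin (fun t => op_comp (q t) (fun j => r (pt j)))))
  => n z f p.
rewrite -[LHS]/(comp_map _ (comp_act (comp_act (cgen z p) q) r)).
rewrite -[RHS]/(comp_act (cgen z p) _) !comp_actE comp_mapE.
congr pgen; apply: CGen_eq => [[t [y w]]|j e ve] //=.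
pose r' (x : tot (fun t : fib f j => J (sval t))) :=
  r (sval (fib_tot_bij f J j x)).
have A := op_compA (p j) (fun t : fib f j => q (sval t)) r'.
rewrite -[in LHS](A : _ = op_comp (p j) (fun t : fib f j =>
  op_comp (q (sval t)) (fun y => r (pt y)))).
rewrite -[in RHS](op_comp_natural (s := fib_tot_bij f J j)
  (t := fun x => bij_id (K (sval (fib_tot_bij f J j x)))) _ (q := r'));
  last by move=> x; rewrite sp_map_id.
rewrite -!sp_map_comp; apply: sp_map_eq => -[[[t ft] y] w]; apply: val_inj.
by rewrite /= ve.
Qed.

Lemma comp_act1 (T : finType) (m : comp_sp T) :
  sp_map comp_sp (unitr_bij T) (comp_act m (fun=> op_id P)) = m.
Proof.
apply: (comp_ext
  (f := comp_map (unitr_bij T) \o comp_act_lin (fun=> op_id P))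
  (g := idfun)) => n z f p.
rewrite -[LHS]/(comp_map _ (comp_act (cgen z p) _)) comp_actE comp_mapE.
congr pgen; apply: CGen_eq => [t|j e ve] //=.
rewrite -[p j in LHS]op_comp1r -!sp_map_comp.
apply: sp_map_eq => -[t []]; apply: val_inj.
by rewrite /= ve.
Qed.

Definition free_rmod : rmod P :=
  RMod comp_act_linear comp_act_multilinear comp_act_natural comp_actA
    comp_act1.

End Composite.

Section Schur.
Variables (k : fieldType) (Z : species k).

(* The evaluation (+)_n Z(n) (x)_{S_n} V^{(x) n}. *)
Inductive schur_gen (V : lmodType k) : Type :=
  SGen (n : nat) (z : Z 'I_n) (v : 'I_n -> V).

Inductive schur_rel (V : lmodType k) :
    term k (schur_gen V) -> term k (schur_gen V) -> Prop :=
| SR_linear n (c : k) (z z' : Z 'I_n) (v : 'I_n -> V) :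
    schur_rel (Tgen _ (SGen (c *: z + z') v))
              (Tadd (Tscale c (Tgen _ (SGen z v))) (Tgen _ (SGen z' v)))
| SR_multilinear n (z : Z 'I_n) (i : 'I_n) (c : k) (u u' v : 'I_n -> V) :
    v i = c *: u i + u' i -> (forall x, x != i -> u x = v x /\ u' x = v x) ->
    schur_rel (Tgen _ (SGen z v))
              (Tadd (Tscale c (Tgen _ (SGen z u))) (Tgen _ (SGen z u')))
| SR_equivariant n (s : bij 'I_n 'I_n) (z : Z 'I_n) (v : 'I_n -> V) :
    schur_rel (Tgen _ (SGen (sp_map Z s z) v))
              (Tgen _ (SGen z (fun x => v (s x)))).

Definition schur (V : lmodType k) : lmodType k := pres (@schur_rel V).

Definition sgen (V : lmodType k) n (z : Z 'I_n) (v : 'I_n -> V) : schur V :=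
  pgen _ (SGen z v).

Section Map.
Variables (V W : lmodType k) (f : {linear V -> W}).

Definition schur_map_gen (x : schur_gen V) : schur W :=
  let: SGen n z v := x in sgen z (fun i => f (v i)).

Lemma schur_map_subproof s t :
  schur_rel s t -> teval schur_map_gen s = teval schur_map_gen t.
Proof.
case=> {s t} /=.
- by move=> n c z z' v; apply: (pgen_rel (SR_linear _ _ _ _)).
- move=> n z i c u u' v vi vx.
  apply: (pgen_rel (SR_multilinear (i := i) _ _ _)) => [|x xi].
    by rewrite vi linearP.
  by have [-> ->] := vx x xi.
- by move=> n s z v; apply: (pgen_rel (SR_equivariant _ _ _)).
Qed.

Definition schur_map : {linear schur V -> schur W} := plift schur_map_subproof.

Lemma schur_mapE n (z : Z 'I_n) (v : 'I_n -> V) :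
  schur_map (sgen z v) = sgen z (fun i => f (v i)).
Proof. exact: (plift_gen schur_map_subproof). Qed.
End Map.
End Schur.

Record algebra (k : fieldType) (P : operad k) := Algebra {
  alg_sp :> lmodType k;
  alg_act : forall I : finType, P I -> (I -> alg_sp) -> alg_sp;
  alg_act_linear : forall (I : finType) (a : I -> alg_sp),
    linear (fun p : P I => alg_act p a);
  alg_act_multilinear : forall (I : finType) (p : P I),
    @multilinear k I (fun=> alg_sp) alg_sp (fun a => alg_act p a);
  alg_act_natural : forall (I J : finType) (s : bij I J) (p : P I)
      (a : J -> alg_sp),
    alg_act (sp_map P s p) a = alg_act p (fun i => a (s i));
  alg_act_comp : forall (I : finType) (J : I -> finType) (p : P I)
      (q : forall i, P (J i)) (a : tot J -> alg_sp),
    alg_act (op_comp p q) a =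
    alg_act p (fun i => alg_act (q i) (fun j => a (pt j)));
  alg_act1 : forall a : unit -> alg_sp, alg_act (op_id P) a = a tt }.

Record alg_hom (k : fieldType) (P : operad k) (L L' : algebra P) := AlgHom {
  ah_fun :> {linear L -> L'};
  ah_act : forall (I : finType) (p : P I) (a : I -> L),
    ah_fun (alg_act p a) = alg_act p (fun i => ah_fun (a i)) }.

Section Kahler.
Variables (k : fieldType) (P : operad k).

(* [KGen p a i] is the expression p(a_1, .., d a_i, .., a_m).  In [KR_subst] and
   [KR_leibniz], [e] numbers the inputs of p \circ_i q, [b] are its arguments,
   and [a] are the arguments of p after evaluating q at the i-th input; the
   differential is at an input j <> i, resp. at the input i. *)
Inductive kahler_gen (L : algebra P) : Type :=
  KGen (m : nat) (p : P 'I_m) (a : 'I_m -> L) (i : 'I_m).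

Inductive kahler_rel (L : algebra P) :
    term k (kahler_gen L) -> term k (kahler_gen L) -> Prop :=
| KR_linear m (c : k) (p p' : P 'I_m) (a : 'I_m -> L) (i : 'I_m) :
    kahler_rel (Tgen _ (KGen (c *: p + p') a i))
               (Tadd (Tscale c (Tgen _ (KGen p a i))) (Tgen _ (KGen p' a i)))
| KR_multilinear m (p : P 'I_m) (j : 'I_m) (c : k) (b b' a : 'I_m -> L)
    (i : 'I_m) :
    a j = c *: b j + b' j -> (forall x, x != j -> b x = a x /\ b' x = a x) ->
    kahler_rel (Tgen _ (KGen p a i))
               (Tadd (Tscale c (Tgen _ (KGen p b i))) (Tgen _ (KGen p b' i)))
| KR_equivariant m (s : bij 'I_m 'I_m) (p : P 'I_m) (a : 'I_m -> L)
    (i : 'I_m) :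
    kahler_rel (Tgen _ (KGen (sp_map P s p) a (s i)))
               (Tgen _ (KGen p (fun x => a (s x)) i))
| KR_subst m n l (p : P 'I_m) (q : P 'I_n) (i : 'I_m)
    (e : bij (graft 'I_n i) 'I_l) (a : 'I_m -> L) (b : 'I_l -> L)
    (j : {x : 'I_m | x != i}) :
    a i = alg_act q (fun y => b (e (inr y))) ->
    (forall x : {x : 'I_m | x != i}, a (sval x) = b (e (inl x))) ->
    kahler_rel (Tgen _ (KGen p a (sval j)))
               (Tgen _ (KGen (sp_map P e (pcomp p i q)) b (e (inl j))))
| KR_leibniz m n l (p : P 'I_m) (q : P 'I_n) (i : 'I_m)
    (e : bij (graft 'I_n i) 'I_l) (a : 'I_m -> L) (b : 'I_l -> L) :
    a i = alg_act q (fun y => b (e (inr y))) ->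
    (forall x : {x : 'I_m | x != i}, a (sval x) = b (e (inl x))) ->
    kahler_rel (Tgen _ (KGen p a i))
               (\big[@Tadd k _/@Tzero k _]_(y < n)
                  Tgen _ (KGen (sp_map P e (pcomp p i q)) b (e (inr y)))).

Definition kahler (L : algebra P) : lmodType k := pres (@kahler_rel L).

Definition kgen (L : algebra P) m (p : P 'I_m) (a : 'I_m -> L) (i : 'I_m) :
    kahler L := pgen _ (KGen p a i).

Lemma teval_big (X : Type) (V : lmodType k) (g : X -> V) (n : nat)
    (t : 'I_n -> term k X) :
  teval g (\big[@Tadd k X/@Tzero k X]_(y < n) t y) = \sum_(y < n) teval g (t y).
Proof. exact: (big_morph (teval g)). Qed.

Section Map.
Variables (L L' : algebra P) (f : alg_hom L L').

Definition kahler_map_gen (x : kahler_gen L) : kahler L' :=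
  let: KGen m p a i := x in kgen p (fun x => f (a x)) i.

Lemma kahler_map_subproof s t :
  kahler_rel s t -> teval kahler_map_gen s = teval kahler_map_gen t.
Proof.
case=> {s t} /=.
- by move=> m c p p' a i; apply: (pgen_rel (KR_linear _ _ _ _ _)).
- move=> m p j c b b' a i aj ax.
  apply: (pgen_rel (KR_multilinear (j := j) _ _ _ _)) => [|x xj].
    by rewrite aj linearP.
  by have [-> ->] := ax x xj.
- by move=> m s p a i; apply: (pgen_rel (KR_equivariant _ _ _ _)).
- move=> m n l p q i e a b j ai ax.
  have /pgen_rel : kahler_rel (Tgen k (KGen p (fun x => f (a x)) (sval j)))
      (Tgen _ (KGen (sp_map P e (pcomp p i q)) (fun x => f (b x)) (e (inl j)))).
    by apply: KR_subst => [|x]; rewrite ?ai ?ah_act ?ax.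
  by [].
- move=> m n l p q i e a b ai ax; rewrite teval_big.
  have /pgen_rel : kahler_rel (Tgen k (KGen p (fun x => f (a x)) i))
      (\big[@Tadd k _/@Tzero k _]_(y < n)
         Tgen _ (KGen (sp_map P e (pcomp p i q)) (fun x => f (b x))
                      (e (inr y)))).
    by apply: KR_leibniz => [|x]; rewrite ?ai ?ah_act ?ax.
  by rewrite teval_big.
Qed.

Definition kahler_map : {linear kahler L -> kahler L'} :=
  plift kahler_map_subproof.

Lemma kahler_mapE m (p : P 'I_m) (a : 'I_m -> L) (i : 'I_m) :
  kahler_map (kgen p a i) = kgen p (fun x => f (a x)) i.
Proof. exact: (plift_gen kahler_map_subproof). Qed.
End Map.
End Kahler.

(* The underlying vector space of the Kahler differentials of L is isomorphic to
   the evaluation of Z on L, naturally in the P-algebra L. *)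
Definition kahler_PBW (k : fieldType) (P : operad k) (Z : species k) : Prop :=
  exists alpha : forall L : algebra P, {linear kahler L -> schur Z L},
    (forall L, bijective (alpha L)) /\
    (forall (L L' : algebra P) (f : alg_hom L L') (w : kahler L),
       alpha L' (kahler_map f w) = schur_map Z f (alpha L w)).

Definition freely_generated (k : fieldType) (P : operad k) (M : rmod P)
    (Z : species k) : Prop :=
  rmod_iso M (free_rmod Z P).

(* Main.v *)
Require Import Defs.
From HB Require Import structures.
From mathcomp Require Import all_boot all_algebra.
From mathcomp Require Import boolp.
(* [bij_comp] and [bij_inj] must be those of [Defs], not those of ssrfun. *)
Import Defs.

Set Implicit Arguments.
Unset Strict Implicit.
Unset Printing Implicit Defensive.

Import GRing.Theory.
Local Open Scope ring_scope.

(* The space of Kahler differentials of L is the relative composite product of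
   Omega with L over P, and the evaluation of Z on L is that of Z o P with L; an
   isomorphism between the right modules Omega and Z o P thus induces a natural
   isomorphism between the two.

   Conversely, apply a natural isomorphism to the free algebras F_I on finite
   sets I.  For a right module M, the multilinear elements m(e_i : i in I) of
   the relative composite product of M with F_I form a copy of M(I): they are
   detected by an algebra whose elements are the families of invariants of
   P(n) (x) (k^I)^{(x) n}.  In characteristic zero they are exactly the common
   eigenvectors, with eigenvalue 2, of the endomorphisms that double a single
   generator, so naturality makes the isomorphism restrict to a map
   Omega(I) -> (Z o P)(I), and naturality with respect to morphisms F_I -> F_J
   makes this restriction a morphism of right modules. *)

(** * Cones over a right module and an algebra *)

(** Cones describe maps out of the relative composite product without constructing it, so that the
    Kahler differentials and the Schur evaluation can be treated alike. The relations of [kahler L]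
    concern one partial composition over ordinals at a time, while a right module acts by total
    compositions over arbitrary finite sets; the gap is bridged by filling one input at a time and
    leaving units at the others. The free algebra is known only through its universal property and
    has no normal form, so the injectivity of m |-> m(e_i : i in I) requires a test algebra. There,
    the natural families multiply by a substitution product, and the coefficient at the identity
    colouring I -> I gives m back. As for the eigenvectors, a monomial in which e_i occurs d times
    is multiplied by 2^d when e_i is doubled, and 2^d = 2 forces d = 1 in characteristic zero. A
    common eigenvector is therefore a combination of monomials containing every generator exactly
    once, and such a monomial is a relabelled element of M(I). *)

Definition enum_bij (T : finType) : bij T 'I_#|T| :=
  Bij (@enum_rankK T) (@enum_valK T).

Lemma bij_card (A B : finType) (s : bij A B) : #|A| = #|B|.
Proof.
by apply: bij_eq_card; exists (bij_inv s); [exact: bijK|exact: bijVK].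
Qed.

Lemma linear_zero (k : fieldType) (U V : lmodType k) (f : U -> V) :
  linear f -> f 0 = 0.
Proof.
move=> fl; have := fl (-1) 0 0.
by rewrite scaler0 addr0 scaleN1r addNr.
Qed.

Lemma linear_sum_fun (k : fieldType) (U V : lmodType k) (f : U -> V) :
  linear f -> forall (J : Type) (r : seq J) (Q : pred J) (F : J -> U),
  f (\sum_(j <- r | Q j) F j) = \sum_(j <- r | Q j) f (F j).
Proof.
move=> fl J r Q F; apply: (big_morph f _ (linear_zero fl)) => u v.
by have := fl 1 u v; rewrite !scale1r.
Qed.

(** Multilinearity with [c = -1] and all three families equal to [u] gives [g u = - g u + g u]; it
    applies because [u i] is zero. *)
Lemma multilinear_zero (k : fieldType) (I : finType) (E : I -> lmodType k)
    (F : lmodType k) (g : (forall i, E i) -> F) (i : I) (u : forall i, E i) :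
  multilinear g -> u i = 0 -> g u = 0.
Proof.
move=> gm ui; have := gm i (-1) u u u.
by rewrite ui scaler0 addr0 scaleN1r addNr => ->.
Qed.

Section Cone.
Variables (k : fieldType) (P : operad k).

(* A cone with vertex [V] is the same thing as a linear map from the relative
   composite product of [M] and [L] over [P] to [V]. *)
Record cone (M : rmod P) (L : algebra P) (V : lmodType k) := Cone {
  cone_fun :> forall T : finType, (T -> L) -> M T -> V;
  cone_linear : forall (T : finType) (a : T -> L), linear (cone_fun a);
  cone_multilinear : forall (T : finType) (m : M T),
    @multilinear k T (fun=> L) V (fun a => cone_fun a m);
  cone_natural : forall (T T' : finType) (s : bij T T') (a : T' -> L)
      (m : M T),
    cone_fun a (sp_map M s m) = cone_fun (fun t => a (s t)) m;
  cone_act : forall (T : finType) (J : T -> finType) (m : M T)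
      (q : forall t, P (J t)) (a : tot J -> L),
    cone_fun a (rm_act m q) =
    cone_fun (fun t => alg_act (q t) (fun j => a (pt j))) m }.

Lemma alg_act_gop_eq (L : algebra P) (I J : finType) (i : I) (q : P J)
    (b : graft J i -> L) :
  alg_act (gop i q i) (fun j => b (graft_bij J i (pt j))) =
  alg_act q (fun y => b (inr y)).
Proof.
(* Both [gop] and [graft_fun] match on [i == i]; the boolean is generalised together with its
   equation so that they reduce simultaneously. *)
have E b' (e : (i == i) = b') : b' = true ->
    alg_act (match b' as b return P (if b then J else unit : finType) with
      true => q | false => op_id P end)
      (fun j => b (graft_case e j)) = alg_act q (fun y => b (inr y)).
  by case: b' e.
exact: E (eqxx i).
Qed.

Lemma alg_act_gop_neq (L : algebra P) (I J : finType) (i : I) (q : P J)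
    (b : graft J i -> L) (x : I) (xi : x != i) :
  alg_act (gop i q x) (fun j => b (graft_bij J i (pt j))) =
  b (inl (exist _ x xi)).
Proof.
have E b' (e : (x == i) = b') : b' = false ->
    alg_act (match b' as b return P (if b then J else unit : finType) with
      true => q | false => op_id P end)
      (fun j => b (graft_case e j)) = b (inl (exist _ x xi)).
  case: b' e => // e _; rewrite alg_act1 /=.
  by congr (b (inl _)); apply: val_inj.
by apply: E; apply/negbTE.
Qed.

(** The cone condition for a single partial composition, in the shape of the hypotheses of
    [KR_subst] and [KR_leibniz]; at inputs other than [i] a unit is inserted, which acts
    trivially. *)
Lemma cone_rpcomp (M : rmod P) (L : algebra P) (V : lmodType k)
    (E : cone M L V) (I J : finType) (m : M I) (i : I) (q : P J)
    (a : I -> L) (b : graft J i -> L) :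
    a i = alg_act q (fun y => b (inr y)) ->
    (forall x : {x | x != i}, a (sval x) = b (inl x)) ->
  E _ b (rpcomp m i q) = E _ a m.
Proof.
move=> ai ax; rewrite /rpcomp cone_natural cone_act.
congr (cone_fun E _ m); apply: funext => x.
have [->|xi] := eqVneq x i; first by rewrite alg_act_gop_eq ai.
by rewrite (alg_act_gop_neq _ _ xi) -ax.
Qed.

End Cone.

Section KahlerLift.
Variables (k : fieldType) (P : operad k) (L : algebra P) (V : lmodType k).
Variable E : cone (Omega P) L V.

Definition kahler_lift_gen (x : kahler_gen L) : V :=
  let: KGen m p a i := x in E _ a (dpair p i).

Lemma dpair_linear (I : finType) (i : I) : linear ((@dpair k P I)^~ i).
Proof.
move=> c p q; apply/ffunP => x; rewrite !ffunE.
by case: eqP => // _; rewrite scaler0 addr0.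
Qed.

Lemma sp_map_dpair (I J : finType) (s : bij I J) (p : P I) (i : I) :
  sp_map (Omega P) s (dpair p i) = dpair (sp_map P s p) (s i).
Proof.
apply/ffunP => x; rewrite !ffunE -[x in RHS](bijVK s) (inj_eq (@bij_inj _ _ s)).
by case: eqP => // _; rewrite linear0.
Qed.

Lemma omega_sum_dpair (I : finType) (w : Omega P I) :
  w = \sum_i dpair ((w : omega_obj P I) i) i.
Proof.
apply/ffunP => x; rewrite sum_ffunE (bigD1 x) //= ffunE eqxx big1 ?addr0 //.
by move=> i ne; rewrite ffunE eq_sym (negbTE ne).
Qed.

(** Substitution and Leibniz both reduce to [cone_rpcomp], through the formulas for the right action
    on [dpair] at distinct and at equal inputs respectively. *)
Lemma kahler_lift_subproof s t :
  kahler_rel s t -> teval kahler_lift_gen s = teval kahler_lift_gen t.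
Proof.
case=> {s t} /=.
- by move=> m c p p' a i; rewrite dpair_linear cone_linear.
- move=> m p j c b b' a i aj ax; exact: (cone_multilinear E _ aj ax).
- by move=> m s p a i; rewrite -sp_map_dpair cone_natural.
- move=> m n l p q i e a b j ai ax.
  rewrite -sp_map_dpair cone_natural.
  have -> : (inl j : graft 'I_n i) = inl (exist _ (sval j) (proj2_sig j)).
    by case: j.
  by rewrite -omega_rpcomp_neq (@cone_rpcomp _ _ _ _ _ E _ _ _ _ _ a).
- move=> m n l p q i e a b ai ax; rewrite teval_big /=.
  under eq_bigr do rewrite -sp_map_dpair cone_natural.
  rewrite -(linear_sum_fun (cone_linear E _)).
  by rewrite -omega_rpcomp_eq (@cone_rpcomp _ _ _ _ _ E _ _ _ _ _ a).
Qed.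

Definition kahler_lift : {linear kahler L -> V} := plift kahler_lift_subproof.

Lemma kahler_liftE m (p : P 'I_m) (a : 'I_m -> L) (i : 'I_m) :
  kahler_lift (kgen p a i) = E _ a (dpair p i).
Proof. exact: (plift_gen kahler_lift_subproof). Qed.

End KahlerLift.

Section KahlerCone.
Variables (k : fieldType) (P : operad k) (L : algebra P).

(** Extends [kgen] from ordinals to finite sets by an enumeration; [KR_equivariant] makes every
    other numbering give the same element. *)
Definition kahler_at (T : finType) (p : P T) (a : T -> L) (i : T) : kahler L :=
  kgen (sp_map P (enum_bij T) p) (fun x => a (bij_inv (enum_bij T) x))
       (enum_bij T i).

Lemma kahler_at_bij (T : finType) m (e : bij T 'I_m) (p : P T) (a : T -> L)
    (i : T) :
  kgen (sp_map P e p) (fun x => a (bij_inv e x)) (e i) = kahler_at p a i.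
Proof.
have Tm : #|T| = m by rewrite (bij_card e) card_ord.
subst m; pose s := bij_comp e (bij_sym (enum_bij T)).
have -> : sp_map P e p = sp_map P s (sp_map P (enum_bij T) p).
  by rewrite -sp_map_comp; apply: sp_map_eq => t; rewrite /= enum_rankK.
have -> : e i = s (enum_bij T i) by rewrite /= enum_rankK.
rewrite [LHS](pgen_rel (KR_equivariant _ _ _ _)) /= -/(kgen _ _ _).
by congr kgen; apply: funext => x; rewrite bijK.
Qed.

Lemma kahler_at_ord m (p : P 'I_m) (a : 'I_m -> L) (i : 'I_m) :
  kahler_at p a i = kgen p a i.
Proof. by rewrite -(kahler_at_bij (bij_id _)) sp_map_id. Qed.

Lemma kahler_at_natural (T T' : finType) (s : bij T T') (p : P T)
    (a : T' -> L) (i : T) :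
  kahler_at (sp_map P s p) a (s i) = kahler_at p (fun t => a (s t)) i.
Proof.
rewrite -[RHS](kahler_at_bij (bij_comp (enum_bij T') s)) /kahler_at.
rewrite sp_map_comp; congr kgen; apply: funext => x /=.
by rewrite bijVK.
Qed.

Definition kahler_eval (T : finType) (a : T -> L) (w : Omega P T) : kahler L :=
  \sum_i kahler_at ((w : omega_obj P T) i) a i.

Lemma kahler_at_linear (T : finType) (a : T -> L) (i : T) :
  linear (fun p : P T => kahler_at p a i).
Proof.
move=> c p q; rewrite /kahler_at linearP.
exact: (pgen_rel (KR_linear _ _ _ _ _)).
Qed.

Lemma kahler_eval_linear (T : finType) (a : T -> L) : linear (kahler_eval a).
Proof.
move=> c u v; rewrite /kahler_eval scaler_sumr -big_split.
apply: eq_bigr => i _.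
by rewrite !ffunE kahler_at_linear.
Qed.

Lemma kahler_eval_dpair (T : finType) (a : T -> L) (p : P T) (i : T) :
  kahler_eval a (dpair p i) = kahler_at p a i.
Proof.
rewrite /kahler_eval (bigD1 i) //= ffunE eqxx big1 ?addr0 // => j ne.
by rewrite ffunE (negbTE ne) (linear_zero (kahler_at_linear a j)).
Qed.

Lemma kahler_eval_multilinear (T : finType) (w : Omega P T) :
  @multilinear k T (fun=> L) _ (fun a => kahler_eval a w).
Proof.
move=> j c u v a aj ax; rewrite /kahler_eval scaler_sumr -big_split.
apply: eq_bigr => i _.
apply: (pgen_rel (KR_multilinear (j := enum_bij T j) _ _ _ _)) => [|x xj] /=.
  by rewrite enum_rankK.
by apply: ax; apply: contraNN xj => /eqP <-; rewrite (bijVK (enum_bij T)).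
Qed.

Lemma kahler_eval_natural (T T' : finType) (s : bij T T') (a : T' -> L)
    (w : Omega P T) :
  kahler_eval a (sp_map (Omega P) s w) = kahler_eval (fun t => a (s t)) w.
Proof.
rewrite /kahler_eval (reindex s) /=; last first.
  by exists (bij_inv s) => x _; [exact: bijK|exact: bijVK].
by apply: eq_bigr => i _; rewrite ffunE bijK kahler_at_natural.
Qed.

(** By linearity [w] is some [dpair p j]: the case [j = i] is the Leibniz relation and the case
    [j != i] the substitution relation. *)
Lemma kahler_eval_rpcomp m n (w : Omega P 'I_m) (i : 'I_m) (q : P 'I_n)
    (a : 'I_m -> L) (b : graft 'I_n i -> L) :
    a i = alg_act q (fun y => b (inr y)) ->
    (forall x : {x | x != i}, a (sval x) = b (inl x)) ->
  kahler_eval b (rpcomp w i q) = kahler_eval a w.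
Proof.
move=> ai ax; rewrite (omega_sum_dpair w).
pose rl := rm_act_linear (r0 := Omega P) (gop i q).
rewrite /rpcomp (linear_sum_fun rl) linear_sum.
rewrite !(linear_sum_fun (kahler_eval_linear _)); apply: eq_bigr => j _.
rewrite -/(rpcomp _ _ _) kahler_eval_dpair kahler_at_ord.
move: {w rl} (_ j : P 'I_m) => p.
pose e := enum_bij (graft 'I_n i).
have [->|ji] := eqVneq j i.
  rewrite omega_rpcomp_eq (linear_sum_fun (kahler_eval_linear _)).
  have /pgen_rel : kahler_rel (Tgen k (KGen p a i))
      (\big[@Tadd k _/@Tzero k _]_(y < n) Tgen _
         (KGen (sp_map P e (pcomp p i q)) (fun x => b (bij_inv e x))
            (e (inr y)))).
    apply: KR_leibniz => [|x]; last by rewrite ax bijK.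
    by rewrite ai; congr alg_act; apply: funext => y; rewrite bijK.
  rewrite teval_big /= -/(kgen _ _ _) => ->.
  by apply: eq_bigr => y _; rewrite kahler_eval_dpair.
rewrite (omega_rpcomp_neq _ _ ji) kahler_eval_dpair.
have /pgen_rel : kahler_rel (Tgen k (KGen p a j))
    (Tgen _ (KGen (sp_map P e (pcomp p i q)) (fun x => b (bij_inv e x))
        (e (inl (exist _ j ji))))).
  apply: (@KR_subst _ _ _ _ _ _ p q i e a _ (exist _ j ji)) => [|x]; last first.
    by rewrite ax bijK.
  by rewrite ai; congr alg_act; apply: funext => y; rewrite bijK.
by [].
Qed.

End KahlerCone.

(** * Total actions from partial compositions *)

Section OpIso.
Variables (k : fieldType) (P : operad k).

(* Bundling an operation with its set of inputs avoids transport along equations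
   between finite types. *)
Definition opkg : Type := {A : finType & P A}.
Definition Opkg (A : finType) (p : P A) : opkg :=
  existT (fun A => P A : Type) A p.

Definition op_iso (x y : opkg) : Prop :=
  exists s : bij (projT1 x) (projT1 y), projT2 y = sp_map P s (projT2 x).

Lemma op_iso_refl x : op_iso x x.
Proof. by exists (bij_id _); rewrite sp_map_id. Qed.

Lemma op_iso_map (A B : finType) (s : bij A B) (p : P A) :
  op_iso (Opkg p) (Opkg (sp_map P s p)).
Proof. by exists s. Qed.

Lemma op_iso_sym x y : op_iso x y -> op_iso y x.
Proof.
case=> s e; exists (bij_sym s).
by rewrite e -sp_map_comp sp_map_eq1 // => t /=; rewrite bijK.
Qed.

Lemma op_iso_trans x y z : op_iso x y -> op_iso y z -> op_iso x z.
Proof. by case=> s e [t e']; exists (bij_comp t s); rewrite sp_map_comp -e. Qed.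

Lemma gop_pkg (I J : finType) (i : I) (q : P J) (x : I) :
  Opkg (gop i q x) = if x == i then Opkg q else Opkg (op_id P).
Proof. by rewrite /gop /gfam; case: (x == i). Qed.

Lemma op_comp_id_iso (J : finType) (K : J -> finType) (q : P J)
    (r : forall j, P (K j)) :
  (forall j, op_iso (Opkg (op_id P)) (Opkg (r j))) ->
  op_iso (Opkg q) (Opkg (op_comp q r)).
Proof.
move=> rid; pose t j := projT1 (cid (rid j)).
have tE j : r j = sp_map P (t j) (op_id P) := projT2 (cid (rid j)).
have := op_comp_natural (s := bij_id J) (t := t) q tE.
rewrite sp_map_id => <-; apply: op_iso_trans (op_iso_map _ _).
by apply: op_iso_sym; rewrite -{2}[q]op_comp1r; apply: op_iso_map.
Qed.

(** A relabelled unit has a single input, necessarily [j], so the composite is [r j] up to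
    relabelling. *)
Lemma op_comp_unit_iso (J : finType) (K : J -> finType) (q : P J)
    (r : forall j, P (K j)) (j : J) :
  op_iso (Opkg (op_id P)) (Opkg q) ->
  op_iso (Opkg (r j)) (Opkg (op_comp q r)).
Proof.
case=> /= s ->.
have ts u : exists t : bij (K j) (K (s u)), r (s u) = sp_map P t (r j).
  have -> : s u = j by rewrite -[j](bijVK s); case: u; case: (bij_inv s j).
  by exists (bij_id _); rewrite sp_map_id.
pose t u := projT1 (cid (ts u)).
have tE u : r (s u) = sp_map P (t u) (r j) := projT2 (cid (ts u)).
have <- := op_comp_natural (s := s) (t := t) (op_id P) tE.
apply: op_iso_trans (op_iso_map _ _).
by apply: op_iso_sym; rewrite -{2}[r j]op_comp1l; apply: op_iso_map.
Qed.

End OpIso.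

Section ActFromPartial.
Variables (k : fieldType) (P : operad k) (M : rmod P) (L : algebra P).
Variables (V : lmodType k) (E : forall T : finType, (T -> L) -> M T -> V).

Hypothesis E_natural : forall (T T' : finType) (s : bij T T') (a : T' -> L)
  (m : M T), E a (sp_map M s m) = E (fun t => a (s t)) m.

Hypothesis E_rpcomp : forall m n (w : M 'I_m) (i : 'I_m) (q : P 'I_n)
    (a : 'I_m -> L) (b : graft 'I_n i -> L),
    a i = alg_act q (fun y => b (inr y)) ->
    (forall x : {x | x != i}, a (sval x) = b (inl x)) ->
  E b (rpcomp w i q) = E a w.

Definition act_compatible (I : finType) (x : I -> opkg P) : Prop :=
  forall (m : M I) (a : tot (fun i => projT1 (x i)) -> L),
    E a (rm_act m (fun i => projT2 (x i))) =
    E (fun i => alg_act (projT2 (x i)) (fun j => a (pt j))) m.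

(** Naturality of the action turns the isomorphisms between [x] and [x'] into a relabelling of the
    total set of inputs, which [E] absorbs. *)
Lemma act_compatible_iso (I I' : finType) (s : bij I I') (x : I -> opkg P)
    (x' : I' -> opkg P) :
  (forall i, op_iso (x i) (x' (s i))) -> act_compatible x' -> act_compatible x.
Proof using E_natural.
move=> xx' cx' m a; pose t i := projT1 (cid (xx' i)).
have tE i : projT2 (x' (s i)) = sp_map P (t i) (projT2 (x i)) :=
  projT2 (cid (xx' i)).
have N := @rm_act_natural _ _ M _ _ _ (fun i => projT1 (x' i)) s t m
  (fun i => projT2 (x i)) (fun i => projT2 (x' i)) tE.
pose h := @tot_bij _ _ _ (fun i => projT1 (x' i)) s t.
pose a' y := a (bij_inv h y).
have -> : a = fun y => a' (h y) by apply: funext => y; rewrite /a' bijK.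
rewrite -(E_natural h a') N cx' E_natural; congr (E _ m); apply: funext => i.
by rewrite tE alg_act_natural.
Qed.

(** By associativity, inserting the composites amounts to inserting [x] and then [y]. *)
Lemma act_compatible_comp (I : finType) (x : I -> opkg P)
    (y : tot (fun i => projT1 (x i)) -> opkg P) :
  act_compatible x -> act_compatible y ->
  act_compatible (fun i => Opkg (op_comp (projT2 (x i))
    (fun j : projT1 (x i) => projT2 (y (pt j))))).
Proof using E_natural.
move=> cx cy m a /=.
have A := @rm_actA _ _ M _ _ (fun z => projT1 (y z)) m
  (fun i => projT2 (x i)) (fun z => projT2 (y z)).
rewrite -[rm_act m _]A E_natural cy cx; congr (E _ m); apply: funext => i.
by rewrite alg_act_comp.
Qed.

Lemma act_compatible_id (I : finType) (x : I -> opkg P) :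
  (forall i, op_iso (Opkg (op_id P)) (x i)) -> act_compatible x.
Proof using E_natural.
move=> xid; apply: (@act_compatible_iso _ _ (bij_id I) _
  (fun=> Opkg (op_id P))) => [i|m a /=]; first exact: op_iso_sym.
rewrite -[m in RHS]rm_act1 E_natural; congr (E _ _).
by apply: funext => -[i []]; rewrite /= alg_act1.
Qed.

Lemma act_compatible_gop (I J : finType) (i : I) (q : P J) :
  act_compatible (fun x => Opkg (gop i q x)).
Proof using E_natural E_rpcomp.
(* [E_rpcomp] is available over ordinals, so [I] and [J] are enumerated first. *)
pose q' := sp_map P (enum_bij J) q.
apply: (@act_compatible_iso _ _ (enum_bij I) _
  (fun x => Opkg (gop (enum_bij I i) q' x))) => [x|m a /=].
  rewrite !gop_pkg (inj_eq (@bij_inj _ _ (enum_bij I))).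
  by case: ifP => _; [exact: op_iso_map|exact: op_iso_refl].
pose h := graft_bij 'I_#|J| (enum_bij I i).
have -> : a = fun y => a (bij_inv h (h y)).
  by apply: funext => y; rewrite bijK.
pose b y := a (bij_inv h y).
rewrite -(E_natural h b) -/(rpcomp m _ _).
apply: E_rpcomp => [|x]; first by rewrite (alg_act_gop_eq _ b).
by case: x => x nx; rewrite (alg_act_gop_neq _ b nx).
Qed.

(* A total composition is an iterated partial one: induct on the set of inputs
   at which something other than the unit is inserted. *)
Lemma act_compatible_all (I : finType) (x : I -> opkg P) : act_compatible x.
Proof using E_natural E_rpcomp.
suff C (s : seq I) : forall x : I -> opkg P,
    (forall i, i \notin s -> op_iso (Opkg (op_id P)) (x i)) -> act_compatible x.
  by apply: (C (enum I)) => i; rewrite mem_enum.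
elim: s => [|i0 s IHs] {}x xs.
  by apply: act_compatible_id => i; apply: xs.
(* The family [x] is built in two stages: [y] keeps a unit at [i0], and [x i0] is then grafted at
   [j0], the only input of that unit. *)
pose y i := if i == i0 then Opkg (op_id P) else x i.
have yi0 : Opkg (op_id P) = y i0 by rewrite /y eqxx.
pose j0 : projT1 (y i0) := ecast z (projT1 z) yi0 tt.
have cy : act_compatible y.
  apply: IHs => i nis; rewrite /y; case: eqP => [_|/eqP ne].
    exact: op_iso_refl.
  by apply: xs; rewrite inE negb_or ne.
have cg := @act_compatible_gop (tot (fun i => projT1 (y i))) _ (pt j0)
  (projT2 (x i0)).
apply: (@act_compatible_iso _ _ (bij_id I) _ _ _ (act_compatible_comp cy cg)).
move=> i /=; have [->|ne] := eqVneq i i0.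
  apply: op_iso_trans (op_comp_unit_iso _ j0 _) => /=.
    by rewrite gop_pkg eqxx; apply: op_iso_refl.
  have -> : Opkg (projT2 (y i0)) = y i0 by case: (y i0).
  by rewrite -yi0; apply: op_iso_refl.
have -> : x i = y i by rewrite /y (negbTE ne).
apply: (@op_iso_trans _ _ _ (Opkg (projT2 (y i)))).
  by case: (y i) => A p; apply: op_iso_refl.
apply: op_comp_id_iso => j /=.
rewrite gop_pkg ifN; first exact: op_iso_refl.
by apply: contraNN ne => /eqP /(congr1 tag) /= ->.
Qed.

Lemma cone_act_of_partial (T : finType) (J : T -> finType) (m : M T)
    (q : forall t, P (J t)) (a : tot J -> L) :
  E a (rm_act m q) = E (fun t => alg_act (q t) (fun j => a (pt j))) m.
Proof using E_natural E_rpcomp.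
exact: (@act_compatible_all T (fun t => Opkg (q t))).
Qed.

End ActFromPartial.

Section KahlerUniversal.
Variables (k : fieldType) (P : operad k).

Definition kahler_cone (L : algebra P) : cone (Omega P) L (kahler L) :=
  Cone (@kahler_eval_linear _ _ L) (@kahler_eval_multilinear _ _ L)
    (@kahler_eval_natural _ _ L)
    (cone_act_of_partial (@kahler_eval_natural _ _ L)
      (@kahler_eval_rpcomp _ _ L)).

Lemma kgen_cone (L : algebra P) m (p : P 'I_m) (a : 'I_m -> L) (i : 'I_m) :
  kgen p a i = kahler_cone L _ a (dpair p i).
Proof. by rewrite /= kahler_eval_dpair kahler_at_ord. Qed.

(** Every cone factors through [kahler_cone]: this is the identification of [kahler L] with the
    relative composite product of [Omega P] and [L]. *)
Lemma kahler_lift_cone (L : algebra P) (V : lmodType k)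
    (E : cone (Omega P) L V) (T : finType) (a : T -> L) (w : Omega P T) :
  kahler_lift E (kahler_cone L _ a w) = E _ a w.
Proof.
rewrite -[kahler_cone L _ a w]/(kahler_eval a w) /kahler_eval linear_sum.
rewrite [in RHS](omega_sum_dpair w) (linear_sum_fun (cone_linear E a)).
apply: eq_bigr => i _.
rewrite /kahler_at kahler_liftE -sp_map_dpair cone_natural.
by congr (cone_fun E _ _); apply: funext => t; rewrite bijK.
Qed.

Lemma kahler_map_cone (L L' : algebra P) (f : alg_hom L L') (T : finType)
    (a : T -> L) (w : Omega P T) :
  kahler_map f (kahler_cone L _ a w) = kahler_cone L' _ (fun t => f (a t)) w.
Proof.
rewrite -[kahler_cone L _ a w]/(kahler_eval a w) /kahler_eval linear_sum.
by apply: eq_bigr => i _; apply: kahler_mapE.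
Qed.

End KahlerUniversal.

(** * The composite product and the evaluation of Schur functors *)

Section TotFib.
Variables (T S : finType) (f : T -> S).

Definition tot_fib_fun (x : tot (fib f)) : T := sval (tagged x).
Definition tot_fib_inv (t : T) : tot (fib f) :=
  @pt S (fib f) (f t) (exist _ t (eqxx (f t))).

Lemma tot_fib_funK : cancel tot_fib_fun tot_fib_inv.
Proof.
case=> i [t ft]; rewrite /tot_fib_fun /tot_fib_inv /=; move: (ft).
by rewrite -(eqP ft) => e; congr pt; apply: val_inj.
Qed.

Definition tot_fib_bij : bij (tot (fib f)) T :=
  Bij tot_fib_funK (fun=> erefl).
End TotFib.

(** Sharpens [op_comp_unit_iso] by prescribing the bijection, as is needed to compare elements and
    not only their isomorphism classes. *)
Lemma op_comp_unitE (k : fieldType) (P : operad k) (J : finType)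
    (K : J -> finType) (s : bij unit J) (r : forall j, P (K j)) (j : J)
    (h : bij (tot K) (K j)) :
    (forall y, h (pt y) = y) ->
  sp_map P h (op_comp (sp_map P s (op_id P)) r) = r j.
Proof.
move=> hE.
have ts u : exists t : bij (K j) (K (s u)),
    r (s u) = sp_map P t (r j) /\ forall y, pt (t y) = pt y :> tot K.
  have -> : s u = j by rewrite -[j](bijVK s); case: u; case: (bij_inv s j).
  by exists (bij_id _); rewrite sp_map_id.
pose t u := projT1 (cid (ts u)).
have tE u : r (s u) = sp_map P (t u) (r j) := proj1 (projT2 (cid (ts u))).
have tpt u y : pt (t u y) = pt y :> tot K := proj2 (projT2 (cid (ts u))) y.
have <- := op_comp_natural (s := s) (t := t) (op_id P) tE.
rewrite -[RHS]op_comp1l -sp_map_comp; apply: sp_map_eq => -[u y] /=.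
by rewrite tpt hE.
Qed.

Section PointBij.
Variables (A : finType) (a : A) (aP : forall x : A, x = a).

Lemma point_bijK : cancel (fun=> a) (fun=> tt).
Proof. by case. Qed.

Lemma point_bijVK : cancel (fun=> tt) (fun=> a).
Proof using aP. by move=> x; rewrite [RHS]aP. Qed.

Definition point_bij : bij unit A := Bij point_bijK point_bijVK.
End PointBij.

Section CompositeUnit.
Variables (k : fieldType) (Z : species k) (P : operad k).

Lemma fib_id_point (T : finType) (j : T) (x : fib id j) :
  x = exist _ j (eqxx j).
Proof. by apply: val_inj; apply/eqP; apply: (proj2_sig x). Qed.

Definition fib_id_bij (T : finType) (j : T) : bij unit (fib id j) :=
  point_bij (@fib_id_point T j).

(** The unit map Z -> Z o P, which carries the universal property of the free module. *)
Definition comp_unit n (z : Z 'I_n) : comp_sp Z P 'I_n :=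
  cgen z (f := id) (fun j => sp_map P (fib_id_bij j) (op_id P)).

Lemma comp_unit_linear n : linear (@comp_unit n).
Proof. by move=> c z z'; apply: (pgen_rel (CR_linear _ _ _ _)). Qed.

Lemma comp_unit_natural n (s : bij 'I_n 'I_n) (z : Z 'I_n) :
  comp_unit (sp_map Z s z) = sp_map (comp_sp Z P) s (comp_unit z).
Proof.
rewrite [RHS]comp_mapE /=.
(* [CR_equivariant] produces the labelling [g], which equals the identity only pointwise; its fibres
   are shown afresh to be points. *)
pose f j := bij_inv s j; pose g j := s (f j).
have gj j : g j == j by rewrite /g /f bijVK.
have gP j (x : fib g j) : x = exist _ j (gj j).
  by apply: val_inj; rewrite -[LHS](bijVK s); apply/eqP/(proj2_sig x).
rewrite -[RHS](pgen_rel (CR_equivariant (s := s)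
  (p' := fun j => sp_map P (point_bij (gP j)) (op_id P)) _ _)); last first.
  by move=> j; rewrite -!sp_map_comp; apply: sp_map_eq => -[]; apply: val_inj.
congr pgen; apply: CGen_eq => [t|j e ve]; first by rewrite /f bijVK.
rewrite -sp_map_comp; apply: sp_map_eq => -[]; apply: val_inj.
by rewrite /= ve.
Qed.

(** The right action generates Z o P from the elements [comp_unit z], so a cone over the free module
    is determined by its values on them. *)
Lemma cgen_comp_unit (T : finType) n (z : Z 'I_n) (f : T -> 'I_n)
    (p : forall j, P (fib f j)) :
  cgen z p = sp_map (comp_sp Z P) (tot_fib_bij f)
    (rm_act (comp_unit z : free_rmod Z P 'I_n) p).
Proof.
rewrite [rm_act _ _]comp_actE [RHS]comp_mapE.
congr pgen; apply: CGen_eq => [t|j e ve] //=.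
pose h : bij (tot (fun t : fib id j => fib f (sval t))) (fib f j) :=
  bij_comp (bij_sym e) (bij_comp (fib_relabel (tot_fib_bij f) tag j)
    (fib_tot_bij id (fib f) j)).
have H := @op_comp_unitE _ P _ _ (fib_id_bij j)
  (fun t : fib id j => p (sval t)) (exist _ j (eqxx j)) h.
rewrite -[p j]H.
  rewrite -!sp_map_comp; apply: sp_map_eq => x /=.
  by rewrite bijVK.
move=> y; rewrite /h /=; apply: (@bij_inj _ _ e); rewrite bijVK.
by apply: val_inj; rewrite /= ve.
Qed.

End CompositeUnit.

Section SchurUniversal.
Variables (k : fieldType) (P : operad k) (Z : species k).

Section Eval.
Variable L : algebra P.

Definition schur_eval_gen (T : finType) (a : T -> L) (x : comp_gen Z P T) :
    schur Z L :=
  let: CGen n z f p := x in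
  sgen z (fun j => alg_act (p j) (fun t => a (sval t))).

Lemma schur_eval_subproof (T : finType) (a : T -> L) s t :
  comp_rel s t -> teval (schur_eval_gen a) s = teval (schur_eval_gen a) t.
Proof.
case=> {s t} /=.
- by move=> n c z z' f p; apply: (pgen_rel (SR_linear _ _ _ _)).
- move=> n z f j c u v p pj px.
  apply: (pgen_rel (SR_multilinear (i := j) _ _ _)) => [|x xj].
    by rewrite pj alg_act_linear.
  by have [-> ->] := px x xj.
- move=> n s z f p p' pp'; rewrite [LHS](pgen_rel (SR_equivariant _ _ _)) /=.
  by congr (pgen _ (SGen z _)); apply: funext => j; rewrite pp' alg_act_natural.
Qed.

Definition schur_eval (T : finType) (a : T -> L) :
    {linear comp_obj Z P T -> schur Z L} := plift (@schur_eval_subproof T a).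

Lemma schur_evalE (T : finType) (a : T -> L) n (z : Z 'I_n) (f : T -> 'I_n)
    (p : forall j, P (fib f j)) :
  schur_eval a (cgen z p) =
  sgen z (fun j => alg_act (p j) (fun t => a (sval t))).
Proof. exact: (plift_gen (@schur_eval_subproof T a)). Qed.

Lemma schur_eval_natural (T T' : finType) (s : bij T T') (a : T' -> L)
    (u : comp_sp Z P T) :
  schur_eval a (sp_map (comp_sp Z P) s u) = schur_eval (fun t => a (s t)) u.
Proof.
apply: (comp_ext (f := schur_eval a \o comp_map Z P s)
  (g := schur_eval (fun t => a (s t)))) => n z f p.
rewrite -[LHS]/(schur_eval a (comp_map Z P s (cgen z p))).
rewrite comp_mapE !schur_evalE; congr (sgen z _); apply: funext => j.
by rewrite alg_act_natural.
Qed.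

Lemma schur_eval_act (T : finType) (J : T -> finType) (u : comp_sp Z P T)
    (q : forall t, P (J t)) (a : tot J -> L) :
  schur_eval a (comp_act u q) =
  schur_eval (fun t => alg_act (q t) (fun j => a (pt j))) u.
Proof.
apply: (comp_ext (f := schur_eval a \o comp_act_lin Z q)
  (g := schur_eval (fun t => alg_act (q t) (fun j => a (pt j))))) => n z f p.
rewrite -[LHS]/(schur_eval a (comp_act (cgen z p) q)).
rewrite comp_actE !schur_evalE; congr (sgen z _); apply: funext => j.
by rewrite alg_act_natural alg_act_comp.
Qed.

Lemma schur_eval_multilinear (T : finType) (u : comp_sp Z P T) :
  @multilinear k T (fun=> L) _ (fun a => schur_eval a u).
Proof.
move=> t c b b' a at_ ax.
elim/pres_ind: u => [[n z f p]||u v IHu IHv|d u IHu].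
- rewrite -[pgen _ _]/(cgen z p) !schur_evalE.
  (* The argument at [t] enters only the factor over [f t]. *)
  apply: (pgen_rel (SR_multilinear (i := f t) _ _ _)) => [|j jt].
    apply: (@alg_act_multilinear _ _ L _ _ (exist _ t (eqxx (f t)))) => //.
    move=> [x fx] nx; apply: ax; apply: contraNN nx => /eqP e.
    exact/eqP/val_inj.
  have E (x : fib f j) : b (sval x) = a (sval x) /\ b' (sval x) = a (sval x).
    apply: ax; apply: contraNN jt => /eqP <-; rewrite eq_sym.
    exact: (proj2_sig x).
  by split; congr alg_act; apply: funext => x; have [] := E x.
- by rewrite !linear0 addr0.
- by rewrite !linearD IHu IHv /= addrACA.
- have E y : schur_eval y (d *: u) = d *: schur_eval y u := linearZ_LR _ _ _.
  by rewrite !E IHu scalerDr !scalerA mulrC.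
Qed.

Lemma schur_eval_linear (T : finType) (a : T -> L) :
  linear (fun u : free_rmod Z P T => schur_eval a u).
Proof. by move=> c u v; rewrite linearP. Qed.

Definition schur_cone : cone (free_rmod Z P) L (schur Z L) :=
  Cone schur_eval_linear schur_eval_multilinear schur_eval_natural
    schur_eval_act.

Lemma sgen_cone n (z : Z 'I_n) (v : 'I_n -> L) :
  sgen z v = schur_cone _ v (comp_unit P z).
Proof.
rewrite [RHS]schur_evalE; congr (sgen z _); apply: funext => j.
by rewrite alg_act_natural alg_act1.
Qed.

End Eval.

Section Lift.
Variables (L : algebra P) (V : lmodType k) (E : cone (free_rmod Z P) L V).

Definition schur_lift_gen (x : schur_gen Z L) : V :=
  let: SGen n z v := x in E _ v (comp_unit P z).

Lemma schur_lift_subproof s t :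
  schur_rel s t -> teval schur_lift_gen s = teval schur_lift_gen t.
Proof.
case=> {s t} /=.
- by move=> n c z z' v; rewrite comp_unit_linear cone_linear.
- by move=> n z i c u u' v vi vx; apply: (cone_multilinear E _ vi vx).
- by move=> n s z v; rewrite comp_unit_natural cone_natural.
Qed.

Definition schur_lift : {linear schur Z L -> V} := plift schur_lift_subproof.

Lemma schur_liftE n (z : Z 'I_n) (v : 'I_n -> L) :
  schur_lift (sgen z v) = E _ v (comp_unit P z).
Proof. exact: (plift_gen schur_lift_subproof). Qed.

Lemma schur_lift_cone (T : finType) (a : T -> L) (u : free_rmod Z P T) :
  schur_lift (schur_cone L _ a u) = E _ a u.
Proof.
pose Ea : {linear free_rmod Z P T -> V} := HB.pack (cone_fun E a)
  (GRing.isLinear.Build k _ _ *:%R (cone_fun E a) (cone_linear E a)).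
apply: (comp_ext (f := schur_lift \o schur_eval a) (g := Ea)) => n z f p.
rewrite -[LHS]/(schur_lift (schur_eval a (cgen z p))) -[RHS]/(E _ a (cgen z p)).
rewrite schur_evalE schur_liftE cgen_comp_unit.
by rewrite (cone_natural E) cone_act.
Qed.

End Lift.

Lemma schur_map_cone (L L' : algebra P) (f : alg_hom L L') (T : finType)
    (a : T -> L) (u : free_rmod Z P T) :
  schur_map Z f (schur_cone L _ a u) = schur_cone L' _ (fun t => f (a t)) u.
Proof.
apply: (comp_ext (f := schur_map Z f \o schur_eval a)
  (g := schur_eval (fun t => f (a t)))) => n z g p.
rewrite -[LHS]/(schur_map Z f (schur_eval a (cgen z p))) !schur_evalE.
rewrite schur_mapE; congr (sgen z _); apply: funext => j.
by rewrite ah_act.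
Qed.

End SchurUniversal.

Lemma kahler_ext (k : fieldType) (P : operad k) (L : algebra P)
    (V : lmodType k) (f g : {linear kahler L -> V}) :
    (forall (T : finType) (a : T -> L) (w : Omega P T),
       f (kahler_cone L _ a w) = g (kahler_cone L _ a w)) ->
  f =1 g.
Proof.
move=> fg; apply: pres_ext => -[m p a i].
by rewrite -[pgen _ _]/(kgen p a i) kgen_cone.
Qed.

Lemma schur_ext (k : fieldType) (P : operad k) (Z : species k) (L : algebra P)
    (V : lmodType k) (f g : {linear schur Z L -> V}) :
    (forall (T : finType) (a : T -> L) (u : free_rmod Z P T),
       f (schur_cone Z L _ a u) = g (schur_cone Z L _ a u)) ->
  f =1 g.
Proof.
move=> fg; apply: pres_ext => -[n z v].
by rewrite -[pgen _ _]/(sgen z v) sgen_cone.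
Qed.

(** * Free generation implies the PBW property *)

Section ConeComp.
Variables (k : fieldType) (P : operad k) (M N : rmod P).
Variable phi : forall I : finType, {linear M I -> N I}.
Hypothesis phi_natural : forall (I J : finType) (s : bij I J) (m : M I),
  phi J (sp_map M s m) = sp_map N s (phi I m).
Hypothesis phi_act : forall (I : finType) (J : I -> finType) (m : M I)
  (q : forall i, P (J i)), phi (tot J) (rm_act m q) = rm_act (phi I m) q.
Variables (L : algebra P) (V : lmodType k) (E : cone N L V).

Definition cone_comp : cone M L V.
Proof using phi_natural phi_act E.
refine (@Cone _ P M L V (fun T a m => E T a (phi T m)) _ _ _ _).
- by move=> T a c u v; rewrite linearP cone_linear.
- by move=> T m; apply: cone_multilinear.
- by move=> T T' s a m; rewrite phi_natural cone_natural.
- by move=> T J m q a; rewrite phi_act cone_act.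
Defined.
End ConeComp.

Lemma rmod_iso_sym (k : fieldType) (P : operad k) (M N : rmod P)
    (phi : forall I : finType, {linear M I -> N I}) :
    (forall I, bijective (phi I)) ->
    (forall (I J : finType) (s : bij I J) (m : M I),
       phi J (sp_map M s m) = sp_map N s (phi I m)) ->
    (forall (I : finType) (J : I -> finType) (m : M I) (q : forall i, P (J i)),
       phi (tot J) (rm_act m q) = rm_act (phi I m) q) ->
  exists psi : forall I : finType, {linear N I -> M I},
    [/\ forall I, cancel (phi I) (psi I), forall I, cancel (psi I) (phi I),
        forall (I J : finType) (s : bij I J) (m : N I),
          psi J (sp_map N s m) = sp_map M s (psi I m)
      & forall (I : finType) (J : I -> finType) (m : N I)
          (q : forall i, P (J i)),
          psi (tot J) (rm_act m q) = rm_act (psi I m) q].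
Proof.
move=> phiB phi_natural phi_act.
have inv I : exists g : N I -> M I, cancel (phi I) g /\ cancel g (phi I).
  by case: (phiB I) => g; exists g.
pose g I := projT1 (cid (inv I)).
have gK I : cancel (phi I) (g I) := proj1 (projT2 (cid (inv I))).
have Kg I : cancel (g I) (phi I) := proj2 (projT2 (cid (inv I))).
pose psi I : {linear N I -> M I} := HB.pack (g I)
  (GRing.isLinear.Build k _ _ *:%R (g I) (can2_linear (gK I) (Kg I))).
exists psi; split=> // [I J s m|I J m q] /=; apply: (can_inj (gK _)).
  by rewrite phi_natural !Kg.
by rewrite phi_act !Kg.
Qed.

Lemma freely_generated_PBW (k : fieldType) (P : operad k) (Z : species k) :
  freely_generated (Omega P) Z -> kahler_PBW P Z.
Proof.
case=> phi [phiB phiN phiA].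
have [psi [phiK psiK psiN psiA]] := rmod_iso_sym phiB phiN phiA.
pose alpha L := kahler_lift (cone_comp phiN phiA (schur_cone Z L)).
pose beta L := schur_lift (cone_comp psiN psiA (kahler_cone L)).
(* On values of the universal cones the two maps are [phi] and [psi]; inverses and naturality are
   then checked on these values alone. *)
have alphaE (L : algebra P) (T : finType) (a : T -> L) (w : Omega P T) :
    alpha L (kahler_cone L _ a w) = schur_cone Z L _ a (phi T w).
  exact: (kahler_lift_cone (cone_comp phiN phiA (schur_cone Z L))).
have betaE (L : algebra P) (T : finType) (a : T -> L) (u : free_rmod Z P T) :
    beta L (schur_cone Z L _ a u) = kahler_cone L _ a (psi T u).
  exact: (schur_lift_cone (cone_comp psiN psiA (kahler_cone L))).
exists alpha; split=> [L|L L' f w].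
  exists (beta L).
    apply: (kahler_ext (f := beta L \o alpha L) (g := idfun)) => T a w.
    rewrite -[LHS]/(beta L (alpha L _)).
    by rewrite alphaE betaE phiK.
  apply: (schur_ext (f := alpha L \o beta L) (g := idfun)) => T a u.
  rewrite -[LHS]/(alpha L (beta L _)).
  by rewrite betaE alphaE psiK.
apply: (kahler_ext (f := alpha L' \o kahler_map f)
  (g := schur_map Z f \o alpha L)) => T a {}w.
rewrite -[LHS]/(alpha L' (kahler_map f _)) -[RHS]/(schur_map Z f (alpha L _)).
by rewrite kahler_map_cone !alphaE schur_map_cone.
Qed.

(** * Convolution algebras of natural families *)

Section MultilinearSum.
Variables (k : fieldType) (I : finType) (E : I -> lmodType k) (F : lmodType k).
Variable g : (forall i, E i) -> F.
Hypothesis gm : multilinear g.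

Lemma multilinear_sum1 (i : I) (X : Type) (r : seq X) (y : X -> E i)
    (w : forall i, E i) :
  w i = \sum_(x <- r) y x -> g w = \sum_(x <- r) g (dfwith w (y x)).
Proof using gm.
elim: r w => [|x r IHr] w; rewrite ?(big_nil, big_cons) => wi.
  exact: multilinear_zero gm wi.
set v := dfwith w (\sum_(x <- r) y x).
rewrite (gm (i := i) (c := 1) (u := dfwith w (y x)) (v := v)); last 2 first.
- by rewrite /v !dfwith_in scale1r.
- by move=> j ji; rewrite /v !dfwith_out // eq_sym.
rewrite scale1r (IHr v); last by rewrite /v dfwith_in.
congr (_ + _); apply: eq_bigr => z _; congr g.
apply: functional_extensionality_dep => j.
have [->|ji] := eqVneq j i; first by rewrite !dfwith_in.
by rewrite /v !dfwith_out // eq_sym.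
Qed.

Lemma multilinear_sum (K : I -> finType) (u : forall i, K i -> E i) :
  g (fun i => \sum_x u i x) =
  \sum_(f : {dffun forall i, K i}) g (fun i => u i (f i)).
Proof using gm.
(* Without a choice function some [K i] is empty: the right-hand sum has no terms, and the [i]-th
   argument on the left is an empty sum. *)
have [f0|nf] := pselect (exists f0 : {dffun forall i, K i}, True); last first.
  rewrite big1 => [|f _]; last by case: nf; exists f.
  have [i Ki] : exists i, K i -> False.
    apply: contrapT => nK; apply: nf.
    have h i : exists x : K i, True.
      by apply: contrapT => nx; apply: nK; exists i => x; apply: nx; exists x.
    by exists [ffun i => projT1 (cid (h i))].
  apply: (multilinear_zero (i := i)) => //.
  by rewrite big1 // => x; case: (Ki x).
(* The sums are expanded one index at a time: indices in [s] are summed over, all others stay frozen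
   at [f0]. *)
pose agree (s : seq I) (f f0 : {dffun forall i, K i}) :=
  [forall i, (i \in s) || (f i == f0 i)].
suff S (s : seq I) : uniq s -> forall f0 : {dffun forall i, K i},
    g (fun i => if i \in s then \sum_x u i x else u i (f0 i)) =
    \sum_(f | agree s f f0) g (fun i => u i (f i)).
  case: f0 => f0 _; have := S (enum I) (enum_uniq _) f0.
  have -> : (fun i => if i \in enum I then \sum_x u i x else u i (f0 i)) =
            (fun i => \sum_x u i x).
    by apply: functional_extensionality_dep => i; rewrite mem_enum.
  by move=> ->; apply: eq_bigl => f; apply/forallP => i; rewrite mem_enum.
elim: s => [_ {}f0|i0 s IHs /= /andP[i0s us] {}f0].
  rewrite (big_pred1 f0) // => f; apply/forallP/eqP => [ff0|-> i] /=.
    by apply/ffunP => i; apply/eqP/ff0.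
  by rewrite eqxx.
rewrite (@multilinear_sum1 i0 _ (index_enum (K i0)) (u i0)); last first.
  by rewrite inE eqxx.
rewrite [RHS](partition_big (fun f : {dffun forall i, K i} => f i0) xpredT) //=.
apply: eq_bigr => x _.
pose f1 : {dffun forall i, K i} := [ffun i => dfwith f0 x i].
have -> : dfwith (fun i => if i \in i0 :: s then \sum_x u i x else u i (f0 i))
    (u i0 x) = fun i => if i \in s then \sum_x u i x else u i (f1 i).
  apply: functional_extensionality_dep => i; rewrite ffunE.
  have [->|ne] := eqVneq i i0; first by rewrite !dfwith_in (negbTE i0s).
  by rewrite !dfwith_out 1?eq_sym // inE (negbTE ne).
rewrite (IHs us f1); apply: eq_bigl => f.
apply/forallP/andP => [ff1|[/forallP ff0 /eqP fi] i].
  split.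
    apply/forallP => i; rewrite inE; case: eqVneq => //= ne.
    by have := ff1 i; rewrite ffunE dfwith_out // eq_sym.
  by have := ff1 i0; rewrite (negbTE i0s) ffunE dfwith_in.
rewrite ffunE; have [->|ne] := eqVneq i i0.
  by rewrite dfwith_in fi eqxx orbT.
by have := ff0 i; rewrite inE (negbTE ne) dfwith_out // eq_sym.
Qed.
End MultilinearSum.

Section NaturalFamilies.
Variables (k : fieldType) (P : species k) (I : Type).

(* The invariants of P(n) (x) (k^I)^{(x) n} under S_n, for all n at once; they
   are indexed by ordinals only, because quantifying over all finite types would
   put [nfam] in too large a universe. *)
Record nfam := NFam {
  nf_ord : forall n, ('I_n -> I) -> P 'I_n;
  nf_ord_natural : forall n (s : bij 'I_n 'I_n) (g : 'I_n -> I),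
    nf_ord g = sp_map P s (nf_ord (fun x => g (s x))) }.

Lemma nfam_eq (x y : nfam) :
  (forall n (g : 'I_n -> I), nf_ord x g = nf_ord y g) -> x = y.
Proof.
case: x y => [x xn] [y yn] /= e.
have E : x = y.
  by do 2![apply: functional_extensionality_dep => ?]; apply: e.
by subst y; congr NFam; apply: Prop_irrelevance.
Qed.

HB.instance Definition _ := gen_eqMixin nfam.
HB.instance Definition _ := gen_choiceMixin nfam.

Definition nfam_zero : nfam.
Proof. by exists (fun n g => 0) => n s g; rewrite linear0. Defined.

Definition nfam_add (x y : nfam) : nfam.
Proof.
exists (fun n g => nf_ord x g + nf_ord y g) => n s g.
by rewrite linearD -!nf_ord_natural.
Defined.

Definition nfam_scale (c : k) (x : nfam) : nfam.
Proof.
exists (fun n g => c *: nf_ord x g) => n s g.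
by rewrite linearZ /= -nf_ord_natural.
Defined.

Lemma nfam_addA : associative nfam_add.
Proof. by move=> x y z; apply: nfam_eq => n g; apply: addrA. Qed.

Lemma nfam_addC : commutative nfam_add.
Proof. by move=> x y; apply: nfam_eq => n g; apply: addrC. Qed.

Lemma nfam_add0 : left_id nfam_zero nfam_add.
Proof. by move=> x; apply: nfam_eq => n g; apply: add0r. Qed.

Lemma nfam_addN : left_inverse nfam_zero (nfam_scale (-1)) nfam_add.
Proof. by move=> x; apply: nfam_eq => n g; rewrite /= scaleN1r addNr. Qed.

HB.instance Definition _ :=
  GRing.isZmodule.Build nfam nfam_addA nfam_addC nfam_add0 nfam_addN.

Lemma nfam_scaleA a b x : nfam_scale a (nfam_scale b x) = nfam_scale (a * b) x.
Proof. by apply: nfam_eq => n g; apply: scalerA. Qed.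

Lemma nfam_scale1 : left_id 1 nfam_scale.
Proof. by move=> x; apply: nfam_eq => n g; apply: scale1r. Qed.

Lemma nfam_scaleDr : right_distributive nfam_scale +%R.
Proof. by move=> c x y; apply: nfam_eq => n g; apply: scalerDr. Qed.

Lemma nfam_scaleDl x : {morph nfam_scale^~ x : a b / a + b}.
Proof. by move=> a b; apply: nfam_eq => n g; apply: scalerDl. Qed.

HB.instance Definition _ :=
  GRing.Zmodule_isLmodule.Build k nfam nfam_scaleA nfam_scale1 nfam_scaleDr
    nfam_scaleDl.

Definition nf (x : nfam) (A : finType) (g : A -> I) : P A :=
  sp_map P (bij_sym (enum_bij A))
    (nf_ord x (fun y => g (bij_inv (enum_bij A) y))).

Lemma nf_bij (x : nfam) (A : finType) n (e : bij A 'I_n) (g : A -> I) :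
  nf x g = sp_map P (bij_sym e) (nf_ord x (fun y => g (bij_inv e y))).
Proof.
have An : #|A| = n by rewrite (bij_card e) card_ord.
subst n; rewrite /nf (nf_ord_natural x (bij_comp (enum_bij A) (bij_sym e))).
rewrite -sp_map_comp.
have -> : (fun y => g (bij_inv (enum_bij A)
    (bij_comp (enum_bij A) (bij_sym e) y))) = fun y => g (bij_inv e y).
  by apply: funext => y; rewrite /= enum_rankK.
by apply: sp_map_eq => y; rewrite /= enum_rankK.
Qed.

Lemma nf_natural (x : nfam) (A B : finType) (s : bij A B) (g : B -> I) :
  nf x g = sp_map P s (nf x (fun a => g (s a))).
Proof.
rewrite (nf_bij x (bij_comp (enum_bij B) s)) -sp_map_comp /nf.
have -> : (fun y => g (s (bij_inv (bij_comp (enum_bij B) s) y))) =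
          fun y => g (bij_inv (enum_bij B) y).
  by apply: funext => y; rewrite /= bijVK.
by apply: sp_map_eq => y; rewrite /= bijVK.
Qed.

Lemma nfP (A : finType) (g : A -> I) c x y :
  nf (c *: x + y) g = c *: nf x g + nf y g.
Proof. by rewrite /nf linearP. Qed.

Section Make.
Variable y : forall A : finType, (A -> I) -> P A.
Hypothesis y_natural : forall (A B : finType) (s : bij A B) (g : B -> I),
  y g = sp_map P s (y (fun a => g (s a))).

Definition mk_nfam : nfam := NFam (fun n => @y_natural 'I_n 'I_n).

Lemma nf_mk (A : finType) (g : A -> I) : nf mk_nfam g = y g.
Proof. by rewrite (y_natural (bij_sym (enum_bij A)) g). Qed.
End Make.

End NaturalFamilies.

Section OpRmod.
Variables (k : fieldType) (P : operad k).

(** With the operad as a right module over itself, one construction [conv] provides both the product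
    of the test algebra and the cones over it. *)
Definition op_rmod : rmod P :=
  @RMod k P P (@op_comp k P) (@op_comp_linear k P) (@op_comp_multilinear k P)
    (@op_comp_natural k P) (@op_compA k P) (@op_comp1r k P).
End OpRmod.

Section Convolution.
Variables (k : fieldType) (P : operad k) (I : Type).
Local Notation nfam := (nfam P I).

Section ConvDef.
Variables (M : rmod P) (A : finType) (g : A -> I) (T : finType) (x : T -> nfam).

Definition conv_term (m : M T) (f : A -> T) : M A :=
  sp_map M (tot_fib_bij f)
    (rm_act m (fun t => nf (x t) (fun a : fib f t => g (sval a)))).

(** The coefficient at [g] of the substitution product of [m] with the families [x t]: the inputs in
    [A] are shared out among them in all possible ways, empty shares included. *)
Definition conv (m : M T) : M A := \sum_(f : {ffun A -> T}) conv_term m f.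

Lemma conv_linear : linear conv.
Proof.
move=> c m m'; rewrite /conv scaler_sumr -big_split; apply: eq_bigr => f _.
by rewrite /conv_term rm_act_linear linearP.
Qed.
End ConvDef.

Lemma conv_multilinear (M : rmod P) (A : finType) (g : A -> I) (T : finType)
    (m : M T) :
  @multilinear k T (fun=> nfam) _ (fun x => conv g x m).
Proof.
move=> t c u v w wt wx; rewrite /conv scaler_sumr -big_split.
apply: eq_bigr => f _; rewrite /conv_term.
pose r (z : T -> nfam) t := nf (z t) (fun a : fib f t => g (sval a)).
have -> : rm_act m (r w) = c *: rm_act m (r u) + rm_act m (r v).
  apply: (@rm_act_multilinear _ _ _ _ _ m t) => [|y yt].
    by rewrite /r wt nfP.
  by rewrite /r; have [-> ->] := wx y yt.
exact: linearP.
Qed.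

Lemma conv_relabel (M : rmod P) (A B : finType) (s : bij A B) (g : B -> I)
    (T : finType) (x : T -> nfam) (m : M T) :
  conv g x m = sp_map M s (conv (fun a => g (s a)) x m).
Proof.
rewrite /conv linear_sum.
rewrite (reindex (fun f : {ffun A -> T} => [ffun b => f (bij_inv s b)])) /=;
  last first.
  exists (fun f : {ffun B -> T} => [ffun a => f (s a)]) => f _;
  by apply/ffunP => y; rewrite !ffunE ?bijK ?bijVK.
apply: eq_bigr => f _; rewrite /conv_term.
set f' := finfun _.
have H t a : (f' (s a) == t) = (f a == t) by rewrite ffunE bijK.
have N := @rm_act_natural _ _ M _ _ _ _ (bij_id T)
  (fun t => @fib_bij _ _ _ _ f f' s t t (H t)) m
  (fun t => nf (x t) (fun a : fib f t => g (s (sval a))))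
  (fun t => nf (x t) (fun a : fib f' t => g (sval a))).
rewrite sp_map_id in N; rewrite -N -?sp_map_comp.
  by apply: sp_map_eq => -[t a].
by move=> t; rewrite (nf_natural _ (@fib_bij _ _ _ _ f f' s t t (H t))).
Qed.

Lemma conv_natural (M : rmod P) (A : finType) (g : A -> I) (T T' : finType)
    (s : bij T T') (x : T' -> nfam) (m : M T) :
  conv g x (sp_map M s m) = conv g (fun t => x (s t)) m.
Proof.
rewrite /conv.
rewrite (reindex (fun f : {ffun A -> T} => [ffun a => s (f a)])) /=; last first.
  exists (fun f : {ffun A -> T'} => [ffun a => bij_inv s (f a)]) => f _;
  by apply/ffunP => y; rewrite !ffunE ?bijK ?bijVK.
apply: eq_bigr => f _; rewrite /conv_term; set f' := finfun _.
have H t a : (f' a == s t) = (f a == t).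
  by rewrite ffunE (inj_eq (@bij_inj _ _ s)).
have N := @rm_act_natural _ _ M _ _ _ _ s
  (fun t => @fib_bij _ _ _ _ f f' (bij_id A) t (s t) (H t)) m
  (fun t => nf (x (s t)) (fun a : fib f t => g (sval a)))
  (fun t => nf (x t) (fun a : fib f' t => g (sval a))).
rewrite -N -?sp_map_comp.
  by apply: sp_map_eq => -[t a].
move=> t.
by rewrite (nf_natural _ (@fib_bij _ _ _ _ f f' (bij_id A) t _ (H t))).
Qed.

Definition nfam_act (T : finType) (p : P T) (x : T -> nfam) : nfam :=
  @mk_nfam _ _ I (fun A g => conv g x (p : op_rmod P T))
    (fun A B s g => @conv_relabel (op_rmod P) A B s g T x p).

Lemma nf_act (T : finType) (p : P T) (x : T -> nfam) (A : finType)
    (g : A -> I) :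
  nf (nfam_act p x) g = conv g x (p : op_rmod P T).
Proof. exact: nf_mk. Qed.

End Convolution.

(* Maps A -> tot J correspond to maps f : A -> T together with a map from each
   fibre of f to J t. *)
Section Refine.
Variables (A T : finType) (J : T -> finType) (f : A -> T).
Variable h : forall t, fib f t -> J t.

Definition refine_fun (a : A) : tot J := pt (h (exist _ a (eqxx (f a)))).

Lemma refine_fun_tag t (j : J t) (a : A) : refine_fun a == pt j -> f a == t.
Proof. by move=> /eqP /(congr1 tag) /= ->. Qed.

Lemma refine_fun_eq t (j : J t) (a : A) (E : refine_fun a == pt j) :
  h (exist _ a (refine_fun_tag E)) == j.
Proof.
move: (refine_fun_tag E) => e; move: (eqP e) => e'; move: j e E.
case: t / e' => j e; rewrite -tag_eqE /tag_eq eqxx /= tagged_asE.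
by rewrite (eq_irrelevance e (eqxx _)).
Qed.

Lemma refine_fun_fib t (j : J t) (y : fib (@h t) j) :
  refine_fun (sval (sval y)) == pt j.
Proof.
case: y => -[a e] /= /eqP <-; move: (e); rewrite -(eqP e) => e'.
by rewrite (eq_irrelevance e' (eqxx _)).
Qed.

Definition refine_fib_fun t (j : J t) (x : fib refine_fun (pt j)) :
    fib (@h t) j :=
  exist _ (exist _ (sval x) (refine_fun_tag (proj2_sig x)))
    (refine_fun_eq (proj2_sig x)).

Definition refine_fib_inv t (j : J t) (y : fib (@h t) j) :
    fib refine_fun (pt j) := exist _ (sval (sval y)) (refine_fun_fib y).

Lemma refine_fib_funK t (j : J t) :
  cancel (@refine_fib_fun t j) (@refine_fib_inv t j).
Proof. by move=> x; apply: val_inj. Qed.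

Lemma refine_fib_invK t (j : J t) :
  cancel (@refine_fib_inv t j) (@refine_fib_fun t j).
Proof. by move=> y; do 2!apply: val_inj. Qed.

Definition refine_fib_bij t (j : J t) :
    bij (fib refine_fun (pt j)) (fib (@h t) j) :=
  Bij (@refine_fib_funK t j) (@refine_fib_invK t j).

End Refine.

Section ConvAct.
Variables (k : fieldType) (P : operad k) (I : Type).
Local Notation nfam := (nfam P I).

(** Associativity of substitution term by term: the fibre of the refined map over [pt j] is the
    fibre of [h t] over [j], and [rm_actA] regroups the two stages. *)
Lemma conv_term_refine (M : rmod P) (A : finType) (g : A -> I) (T : finType)
    (J : T -> finType) (m : M T) (q : forall t, P (J t)) (x : tot J -> nfam)
    (f : A -> T) (h : forall t, fib f t -> J t) :
  conv_term g x (rm_act m q) (refine_fun h) =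
  sp_map M (tot_fib_bij f) (rm_act m (fun t =>
    @conv_term k P I (op_rmod P) (fib f t) (fun a => g (sval a)) (J t)
      (fun j => x (pt j)) (q t) (h t))).
Proof.
pose F := refine_fun h.
pose r (y : tot J) := nf (x y) (fun a : fib F y => g (sval a)).
pose b t := bij_comp (tot_fib_bij (h t))
  (@tot_bij _ _ (fun j : J t => fib F (pt j)) (fib (h t)) (bij_id (J t))
     (@refine_fib_bij _ _ _ _ h t)).
have -> : (fun t => @conv_term k P I (op_rmod P) (fib f t)
      (fun a => g (sval a)) (J t) (fun j => x (pt j)) (q t) (h t)) =
    fun t => sp_map P (b t) (op_comp (q t) (fun j => r (pt j))).
  apply: functional_extensionality_dep => t; rewrite /b sp_map_comp.
  rewrite (@op_comp_natural _ P _ _ _ (fib (h t)) (bij_id (J t))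
    (@refine_fib_bij _ _ _ _ h t) (q t) (fun j => r (pt j)) (fun j =>
      nf (x (pt j)) (fun a : fib (h t) j => g (sval (sval a))))).
    by rewrite sp_map_id.
  by move=> j; rewrite (nf_natural _ (refine_fib_bij h j)).
have N := @rm_act_natural _ _ M _ _ _ (fib f) (bij_id T) b m
  (fun t => op_comp (q t) (fun j => r (pt j)))
  (fun t => sp_map P (b t) (op_comp (q t) (fun j => r (pt j)))) (fun=> erefl).
rewrite sp_map_id in N; rewrite -N -rm_actA -!sp_map_comp.
by apply: sp_map_eq => -[[t j] a].
Qed.

Lemma conv_act (M : rmod P) (A : finType) (g : A -> I) (T : finType)
    (J : T -> finType) (m : M T) (q : forall t, P (J t)) (x : tot J -> nfam) :
  conv g x (rm_act m q) =
  conv g (fun t => nfam_act (q t) (fun j => x (pt j))) m.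
Proof.
(* The left-hand sum over maps [F : A -> tot J] is grouped according to the first component [f] of
   [F]. *)
rewrite /conv (partition_big
  (fun F : {ffun A -> tot J} => [ffun a => tag (F a)]) xpredT) //=.
apply: eq_bigr => f _; rewrite {2}/conv_term.
have -> : (fun t => nf (nfam_act (q t) (fun j => x (pt j)))
      (fun a : fib f t => g (sval a))) =
    (fun t => \sum_(h : {ffun fib f t -> J t})
      @conv_term k P I (op_rmod P) (fib f t) (fun a => g (sval a)) (J t)
      (fun j => x (pt j)) (q t) h).
  by apply: functional_extensionality_dep => t; rewrite nf_act.
rewrite (multilinear_sum (@rm_act_multilinear _ _ M _ _ m)) linear_sum /=.
(* By multilinearity the right-hand term has become a sum over families of maps on the fibres of
   [f]; [R] matches them bijectively with the maps [F] lying over [f]. *)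
pose R (h : {dffun forall t, {ffun fib f t -> J t}}) : {ffun A -> tot J} :=
  [ffun a => refine_fun (fun t => h t) a].
rewrite (eq_bigl (mem (R @: setT))); last first.
  move=> F; apply/eqP/imsetP => [Ff|[h _ ->]]; last first.
    by apply/ffunP => a; rewrite !ffunE.
  have Fa t (a : fib f t) : tag (F (sval a)) = t.
    have /ffunP/(_ (sval a)) := Ff; rewrite ffunE => ->.
    exact/eqP/(proj2_sig a).
  exists [ffun t => [ffun a => ecast z (J z) (Fa t a) (tagged (F (sval a)))]]
    => //.
  apply/ffunP => a; rewrite !ffunE /refine_fun !ffunE /=.
  move: (Fa _ _) => /=; case: (F a) => i j /=.
  by move: (f a) => t e; case: t / e.
rewrite big_imset /=; last first.
  move=> h h' _ _ /ffunP E; apply/ffunP => t; apply/ffunP => a.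
  have := E (sval a); rewrite !ffunE /refine_fun => /eqP.
  case: a => a e /=; move: (e); rewrite -(eqP e) => e'.
  rewrite -tag_eqE /tag_eq eqxx /= tagged_asE.
  by rewrite (eq_irrelevance e' (eqxx _)) => /eqP.
apply: eq_big => [h|h _]; first by rewrite inE.
rewrite -conv_term_refine; congr conv_term.
by apply: funext => a; rewrite ffunE.
Qed.

End ConvAct.

Section NfamAlgebra.
Variables (k : fieldType) (P : operad k) (I : Type).
Local Notation nfam := (nfam P I).

Lemma nfam_act_linear (T : finType) (x : T -> nfam) :
  linear (fun p : P T => nfam_act p x).
Proof.
by move=> c p q; apply: nfam_eq => n g; apply: (@conv_linear _ _ _ (op_rmod P)).
Qed.

Lemma nfam_act_multilinear (T : finType) (p : P T) :
  @multilinear k T (fun=> nfam) nfam (fun x => nfam_act p x).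
Proof.
move=> t c u v w wt wx; apply: nfam_eq => n g.
exact: (@conv_multilinear _ _ _ (op_rmod P) _ g _ p t).
Qed.

Lemma nfam_act_natural (T T' : finType) (s : bij T T') (p : P T)
    (x : T' -> nfam) :
  nfam_act (sp_map P s p) x = nfam_act p (fun t => x (s t)).
Proof. by apply: nfam_eq => n g; apply: (@conv_natural _ _ _ (op_rmod P)). Qed.

Lemma nfam_act_comp (T : finType) (J : T -> finType) (p : P T)
    (q : forall t, P (J t)) (x : tot J -> nfam) :
  nfam_act (op_comp p q) x =
  nfam_act p (fun t => nfam_act (q t) (fun j => x (pt j))).
Proof. by apply: nfam_eq => n g; apply: (@conv_act _ _ _ (op_rmod P)). Qed.

Lemma nfam_act1 (x : unit -> nfam) : nfam_act (op_id P) x = x tt.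
Proof.
apply: nfam_eq => n g.
rewrite -[LHS]/(@conv k P I (op_rmod P) 'I_n g unit x (op_id P)) /conv.
(* There is a single map to [unit], and its fibre is all of ['I_n]. *)
rewrite (big_pred1 [ffun=> tt]) => [|f]; last first.
  by apply/esym/eqP/ffunP => a; rewrite ffunE; case: (f a).
rewrite /conv_term; set f : 'I_n -> unit := fun_of_fin _.
have ft (a : 'I_n) : f a == tt by rewrite /f ffunE.
have cK : cancel sval (fun a => exist _ a (ft a) : fib f tt).
  by move=> a; apply: val_inj.
pose c : bij (fib f tt) 'I_n := Bij cK (fun=> erefl).
pose h := bij_comp (bij_sym c) (tot_fib_bij f).
have U := @op_comp_unitE _ P _ (fib f) (bij_id unit)
  (fun t => nf (x t) (fun a : fib f t => g (sval a))) tt h.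
have -> : nf_ord (x tt) g = nf (x tt) g.
  by rewrite (nf_bij _ (bij_id _)) sp_map_eq1.
rewrite (nf_natural _ c) -U => [|y]; last exact: val_inj.
by rewrite sp_map_id -sp_map_comp; apply: sp_map_eq.
Qed.

Definition nfam_alg : algebra P :=
  Algebra nfam_act_linear nfam_act_multilinear nfam_act_natural nfam_act_comp
    nfam_act1.

Definition conv_cone (M : rmod P) (A : finType) (g : A -> I) :
    cone M nfam_alg (M A) :=
  @Cone k P M nfam_alg (M A) (@conv k P I M A g) (@conv_linear k P I M A g)
    (@conv_multilinear k P I M A g) (@conv_natural k P I M A g)
    (@conv_act k P I M A g).

(** These are the coefficients of the element playing the role of the generator [i]: the identity
    operation with its only input coloured [i]. *)
Definition nfam_unit_at (i : I) (A : finType) (g : A -> I) : P A :=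
  match pselect (exists s : bij unit A, g (s tt) = i) with
  | left e => sp_map P (projT1 (cid e)) (op_id P)
  | right _ => 0
  end.

(** Two bijections from [unit] to the same set agree, so the bijection chosen in the definition is
    immaterial. *)
Lemma nfam_unit_atE (i : I) (A : finType) (g : A -> I) (s : bij unit A) :
  g (s tt) = i -> nfam_unit_at i g = sp_map P s (op_id P).
Proof.
rewrite /nfam_unit_at => gs; case: pselect => [e|[]]; last by exists s.
by apply: sp_map_eq => -[]; rewrite -[RHS](bijVK (projT1 (cid e)));
  case: (bij_inv _ _).
Qed.

Lemma nfam_unit_at0 (i : I) (A : finType) (g : A -> I) :
  (forall s : bij unit A, g (s tt) <> i) -> nfam_unit_at i g = 0.
Proof.
by rewrite /nfam_unit_at => gs; case: pselect => // e; have [s /gs] := e.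
Qed.

Lemma nfam_unit_natural (i : I) (A B : finType) (s : bij A B) (g : B -> I) :
  nfam_unit_at i g = sp_map P s (nfam_unit_at i (fun a => g (s a))).
Proof.
have [[t gt]|ng] := pselect (exists t : bij unit A, g (s (t tt)) = i).
  rewrite (nfam_unit_atE (s := t)) // (nfam_unit_atE (s := bij_comp s t)) //.
  by rewrite sp_map_comp.
rewrite !nfam_unit_at0 ?linear0 // => t gt; apply: ng; first by exists t.
by exists (bij_comp (bij_sym s) t); rewrite /= bijVK.
Qed.

Definition nfam_unit (i : I) : nfam := mk_nfam (@nfam_unit_natural i).

End NfamAlgebra.

(** Only the identity map contributes: if [f i != i], then [i] is not in the fibre of [f] over [i],
    so the factor at [i] vanishes. This is how the test algebra detects [m]. *)
Lemma conv_unit (k : fieldType) (P : operad k) (M : rmod P) (I : finType)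
    (m : M I) :
  conv id (@nfam_unit k P I) m = m.
Proof.
rewrite /conv (bigD1 [ffun i => i]) //= [X in _ + X]big1 ?addr0 => [|f fid].
  rewrite /conv_term.
  have -> : fun_of_fin [ffun i : I => i] = id.
    by apply: funext => i; rewrite ffunE.
  have E (i : I) : nf (nfam_unit P i) (fun a : fib id i => sval a) =
      sp_map P (fib_id_bij i) (op_id P).
    by rewrite nf_mk; apply: nfam_unit_atE.
  have N := @rm_act_natural _ _ M _ _ _ (fib id) (bij_id I)
    (fun i => fib_id_bij i) m (fun=> op_id P)
    (fun i => nf (nfam_unit P i) (fun a : fib id i => sval a)) E.
  rewrite sp_map_id in N; rewrite -[X in sp_map _ _ X]N -sp_map_comp.
  by rewrite -[RHS]rm_act1; apply: sp_map_eq => -[].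
have [i fi] : exists i, f i != i.
  apply/existsP; apply: contraNT fid => /existsPn nf.
  apply/eqP/ffunP => i; rewrite ffunE; apply/eqP.
  by have := nf i; rewrite negbK.
rewrite /conv_term [rm_act _ _](multilinear_zero (i := i)) ?linear0 //.
  exact: rm_act_multilinear.
rewrite nf_mk; apply: nfam_unit_at0 => s si.
by have := proj2_sig (s tt); rewrite si (negbTE fi).
Qed.

(** * Free algebras *)

Section FreeAlgebra.
Variables (k : fieldType) (P : operad k) (I : Type).
Local Open Scope quotient_scope.

Inductive ptm : Type :=
| PVar of I
| PZero
| PAdd of ptm & ptm
| PScale of k & ptm
| POp n of P 'I_n & ('I_n -> ptm).

HB.instance Definition _ := gen_eqMixin ptm.
HB.instance Definition _ := gen_choiceMixin ptm.

Fixpoint peval (L : algebra P) (a : I -> L) (t : ptm) : L :=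
  match t with
  | PVar i => a i
  | PZero => 0
  | PAdd s t => peval a s + peval a t
  | PScale c t => c *: peval a t
  | POp n p x => alg_act p (fun i => peval a (x i))
  end.

(* Identifying terms with the same value in every algebra makes the algebra
   axioms and the universal property immediate. *)
Definition ptm_eq : rel ptm :=
  fun s t => `[< forall (L : algebra P) (a : I -> L), peval a s = peval a t >].

Lemma ptm_eq_refl : reflexive ptm_eq.
Proof. by move=> s; apply/asboolP. Qed.

Lemma ptm_eq_sym : symmetric ptm_eq.
Proof. by move=> s t; apply/asboolP/asboolP => st L a; rewrite st. Qed.

Lemma ptm_eq_trans : transitive ptm_eq.
Proof.
by move=> t s u /asboolP st /asboolP tu; apply/asboolP => L a; rewrite st.
Qed.

Definition ptm_equiv := EquivRel ptm_eq ptm_eq_refl ptm_eq_sym ptm_eq_trans.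

Definition free_carrier : Type := {eq_quot ptm_equiv}.
HB.instance Definition _ := Choice.on free_carrier.

Definition fcl (t : ptm) : free_carrier := \pi_({eq_quot ptm_equiv}) t.

Definition frepr (u : free_carrier) : ptm := repr (u : {eq_quot ptm_equiv}).

Definition free_eval (L : algebra P) (a : I -> L) (u : free_carrier) : L :=
  peval a (frepr u).

Lemma free_eval_cl (L : algebra P) (a : I -> L) (t : ptm) :
  free_eval a (fcl t) = peval a t.
Proof.
have /eqP : fcl (repr (fcl t : {eq_quot ptm_equiv})) = fcl t by apply: reprK.
by rewrite /fcl piE => /asboolP; apply.
Qed.

Lemma free_eval_ext (u v : free_carrier) :
  (forall (L : algebra P) (a : I -> L), free_eval a u = free_eval a v) -> u = v.
Proof.
move=> uv; rewrite -[u](reprK (u : {eq_quot ptm_equiv})).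
rewrite -[v](reprK (v : {eq_quot ptm_equiv})).
by apply/eqP; rewrite piE; apply/asboolP.
Qed.

Definition free_zero : free_carrier := fcl PZero.
Definition free_add (u v : free_carrier) : free_carrier :=
  fcl (PAdd (frepr u) (frepr v)).
Definition free_scale (c : k) (u : free_carrier) : free_carrier :=
  fcl (PScale c (frepr u)).

Lemma free_eval0 (L : algebra P) (a : I -> L) : free_eval a free_zero = 0.
Proof. exact: free_eval_cl. Qed.

Lemma free_evalD (L : algebra P) (a : I -> L) u v :
  free_eval a (free_add u v) = free_eval a u + free_eval a v.
Proof. exact: free_eval_cl. Qed.

Lemma free_evalZ (L : algebra P) (a : I -> L) c u :
  free_eval a (free_scale c u) = c *: free_eval a u.
Proof. exact: free_eval_cl. Qed.

Let free_evalE := (free_eval0, free_evalD, free_evalZ).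

Lemma free_addA : associative free_add.
Proof.
by move=> u v w; apply: free_eval_ext => L a; rewrite !free_evalE addrA.
Qed.

Lemma free_addC : commutative free_add.
Proof.
by move=> u v; apply: free_eval_ext => L a; rewrite !free_evalE addrC.
Qed.

Lemma free_add0 : left_id free_zero free_add.
Proof. by move=> u; apply: free_eval_ext => L a; rewrite !free_evalE add0r. Qed.

Lemma free_addN : left_inverse free_zero (free_scale (-1)) free_add.
Proof.
by move=> u; apply: free_eval_ext => L a; rewrite !free_evalE scaleN1r addNr.
Qed.

HB.instance Definition _ :=
  GRing.isZmodule.Build free_carrier free_addA free_addC free_add0 free_addN.

Lemma free_scaleA a b u : free_scale a (free_scale b u) = free_scale (a * b) u.
Proof. by apply: free_eval_ext => L x; rewrite !free_evalE scalerA. Qed.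

Lemma free_scale1 : left_id 1 free_scale.
Proof.
by move=> u; apply: free_eval_ext => L x; rewrite !free_evalE scale1r.
Qed.

Lemma free_scaleDr : right_distributive free_scale +%R.
Proof.
by move=> c u v; apply: free_eval_ext => L x; rewrite !free_evalE scalerDr.
Qed.

Lemma free_scaleDl u : {morph free_scale^~ u : a b / a + b}.
Proof.
by move=> a b; apply: free_eval_ext => L x; rewrite !free_evalE scalerDl.
Qed.

HB.instance Definition _ :=
  GRing.Zmodule_isLmodule.Build k free_carrier free_scaleA free_scale1
    free_scaleDr free_scaleDl.

Lemma free_eval_linear (L : algebra P) (a : I -> L) : linear (free_eval a).
Proof. by move=> c u v; rewrite [LHS]free_evalD [in LHS]free_evalZ. Qed.

Definition free_act (T : finType) (p : P T) (x : T -> free_carrier) :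
    free_carrier :=
  fcl (POp (sp_map P (enum_bij T) p)
    (fun i => frepr (x (bij_inv (enum_bij T) i)))).

Lemma free_eval_act (L : algebra P) (a : I -> L) (T : finType) (p : P T)
    (x : T -> free_carrier) :
  free_eval a (free_act p x) = alg_act p (fun t => free_eval a (x t)).
Proof.
rewrite [LHS]free_eval_cl /= alg_act_natural; congr alg_act.
by apply: funext => t; rewrite /= enum_rankK.
Qed.

Lemma free_act_linear (T : finType) (x : T -> free_carrier) :
  linear (fun p : P T => free_act p x).
Proof.
move=> c p q; apply: free_eval_ext => L a.
by rewrite free_eval_linear !free_eval_act alg_act_linear.
Qed.

Lemma free_act_multilinear (T : finType) (p : P T) :
  @multilinear k T (fun=> free_carrier) free_carrier (fun x => free_act p x).
Proof.
move=> t c u v w wt wx; apply: free_eval_ext => L a.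
rewrite free_eval_linear !free_eval_act.
apply: (@alg_act_multilinear _ _ _ _ p t) => [|y yt].
  by rewrite wt free_eval_linear.
by have [-> ->] := wx y yt.
Qed.

Lemma free_act_natural (T T' : finType) (s : bij T T') (p : P T)
    (x : T' -> free_carrier) :
  free_act (sp_map P s p) x = free_act p (fun t => x (s t)).
Proof.
by apply: free_eval_ext => L a; rewrite !free_eval_act alg_act_natural.
Qed.

Lemma free_act_comp (T : finType) (J : T -> finType) (p : P T)
    (q : forall t, P (J t)) (x : tot J -> free_carrier) :
  free_act (op_comp p q) x =
  free_act p (fun t => free_act (q t) (fun j => x (pt j))).
Proof.
apply: free_eval_ext => L a; rewrite !free_eval_act alg_act_comp.
by congr alg_act; apply: funext => t; rewrite free_eval_act.
Qed.

Lemma free_act1 (x : unit -> free_carrier) : free_act (op_id P) x = x tt.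
Proof. by apply: free_eval_ext => L a; rewrite free_eval_act alg_act1. Qed.

Definition free_alg : algebra P :=
  Algebra free_act_linear free_act_multilinear free_act_natural free_act_comp
    free_act1.

Definition free_gen (i : I) : free_alg := fcl (PVar i).

Lemma free_eval_gen (L : algebra P) (a : I -> L) (i : I) :
  free_eval a (free_gen i) = a i.
Proof. exact: free_eval_cl. Qed.

Definition free_hom (L : algebra P) (a : I -> L) : alg_hom free_alg L :=
  @AlgHom _ P free_alg L (HB.pack (free_eval a)
    (GRing.isLinear.Build k free_alg L *:%R (free_eval a) (free_eval_linear a)))
    (free_eval_act a).

Lemma free_hom_gen (L : algebra P) (a : I -> L) (i : I) :
  free_hom a (free_gen i) = a i.
Proof. exact: free_eval_gen. Qed.

Lemma free_ind (Q : free_alg -> Prop) :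
    (forall i, Q (free_gen i)) -> Q 0 ->
    (forall c u v, Q u -> Q v -> Q (c *: u + v)) ->
    (forall n (p : P 'I_n) (x : 'I_n -> free_alg), (forall i, Q (x i)) ->
       Q (alg_act p x)) ->
  forall u, Q u.
Proof.
move=> Qg Q0 Ql Qa u; rewrite -[u](reprK (u : {eq_quot ptm_equiv})).
rewrite -[\pi _]/(fcl _).
elim: (repr _) => {u} [i||s IHs t IHt|c t IHt|n p x IHx].
- exact: Qg.
- exact: Q0.
- suff -> : fcl (PAdd s t) = 1 *: (fcl s : free_alg) + fcl t by apply: Ql.
  apply: free_eval_ext => L a.
  by rewrite free_eval_linear scale1r !free_eval_cl.
- suff -> : fcl (PScale c t) = c *: (fcl t : free_alg) + 0 by apply: Ql.
  rewrite addr0; apply: free_eval_ext => L a.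
  by rewrite free_evalZ !free_eval_cl.
- suff -> : fcl (POp p x) = alg_act p (fun i => fcl (x i) : free_alg).
    exact: Qa.
  apply: free_eval_ext => L a; rewrite free_eval_act free_eval_cl /=.
  by congr alg_act; apply: funext => i; rewrite free_eval_cl.
Qed.

End FreeAlgebra.

(** * Multilinear elements over free algebras *)

Definition lin_closed (k : fieldType) (V : lmodType k) (Q : V -> Prop) : Prop :=
  Q 0 /\ forall c u v, Q u -> Q v -> Q (c *: u + v).

(** The impredicative form serves directly as an induction principle, with no linear combination to
    choose. *)
Definition in_span (k : fieldType) (V : lmodType k) (B : V -> Prop) (x : V) :
    Prop :=
  forall Q : V -> Prop, lin_closed Q -> (forall b, B b -> Q b) -> Q x.

Section MultilinearSpan.
Variables (k : fieldType) (T : finType) (L V : lmodType k).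
Variable g : (T -> L) -> V.
Hypothesis gm : @multilinear k T (fun=> L) V g.

(** The arguments are released from [B] to its span one at a time, each time by linearity in that
    argument. *)
Lemma multilinear_span (B : L -> Prop) (Q : V -> Prop) (x : T -> L) :
    lin_closed Q -> (forall y, (forall t, B (y t)) -> Q (g y)) ->
    (forall t, in_span B (x t)) ->
  Q (g x).
Proof using gm.
move=> [Q0 Ql] QB xB.
suff S (s : seq T) : forall x : T -> L, (forall t, in_span B (x t)) ->
    (forall t, t \notin s -> B (x t)) -> Q (g x).
  by apply: (S (enum T)) => // t; rewrite mem_enum.
elim: s => [|t0 s IHs] {xB}x xB xs; first by apply: QB => t; apply: xs.
pose upd y : T -> L := @dfwith _ (fun=> L : Type) x t0 y.
have updE y : upd y t0 = y by apply: dfwith_in.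
have updN y t : t != t0 -> upd y t = x t.
  by move=> ne; apply: dfwith_out; rewrite eq_sym.
have -> : x = upd (x t0).
  by apply: funext => t; have [->|ne] := eqVneq t t0; rewrite ?updE ?updN.
apply: (xB t0 (fun y => Q (g (upd y)))) => [|b Bb].
  split=> [|c u v Qu Qv]; first by rewrite (multilinear_zero (i := t0) gm).
  rewrite (gm (i := t0) (c := c) (u := upd u) (v := upd v)) ?updE //.
    exact: Ql.
  by move=> t ne; rewrite !updN.
apply: IHs => t; have [->|ne] := eqVneq t t0; rewrite ?updE ?updN //.
  by move=> R _; apply.
by move=> ts; apply: xs; rewrite inE negb_or ne.
Qed.

Lemma multilinear_scale1 (t : T) (z : k) (u w : T -> L) :
    w t = z *: u t -> (forall x, x != t -> w x = u x) ->
  g w = z *: g u.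
Proof using gm.
move=> wt wx; pose v := @dfwith _ (fun=> L : Type) u t 0.
rewrite (gm (i := t) (c := z) (u := u) (v := v)).
- by rewrite (multilinear_zero (i := t) (u := v) gm) ?addr0 // /v dfwith_in.
- by rewrite /v dfwith_in addr0.
by move=> x xt; rewrite /v dfwith_out ?wx // eq_sym.
Qed.

Lemma multilinear_scale (R : pred T) (z : k) (u : T -> L) :
  g (fun t => if R t then z *: u t else u t) = z ^+ #|R| *: g u.
Proof using gm.
have S (s : seq T) : uniq s ->
    g (fun t => if t \in s then z *: u t else u t) = z ^+ size s *: g u.
  elim: s => [_|t0 s IHs /= /andP[t0s us]]; first by rewrite scale1r.
  rewrite exprS -scalerA -IHs //; apply: (@multilinear_scale1 t0).
    by rewrite inE eqxx (negbTE t0s).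
  by move=> t tt0; rewrite inE (negbTE tt0).
rewrite cardE -S ?enum_uniq //; congr g; apply: funext => t.
by rewrite mem_enum.
Qed.

End MultilinearSpan.

Section ConeSpan.
Variables (k : fieldType) (P : operad k).

Definition free_monomial (I : Type) (v : free_alg P I) : Prop :=
  exists (T : finType) (p : P T) (c : T -> I),
    v = alg_act p (fun t => free_gen P (c t)).

(** An operation applied to monomials is a monomial, by operadic composition; multilinearity passes
    from monomials to their combinations. *)
Lemma free_span (I : Type) (u : free_alg P I) : in_span (@free_monomial I) u.
Proof.
elim/free_ind: u => [i||c u v IHu IHv|n p x IHx] Q Ql QB.
- by apply: QB; exists unit, (op_id P), (fun=> i); rewrite alg_act1.
- by case: Ql.
- by case: (Ql) => Q0; apply; [apply: IHu|apply: IHv].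
apply: (multilinear_span (alg_act_multilinear p) Ql _ IHx) => y ym.
pose J t := projT1 (cid (ym t)).
pose q t : P (J t) := projT1 (cid (projT2 (cid (ym t)))).
pose c t : J t -> I := projT1 (cid (projT2 (cid (projT2 (cid (ym t)))))).
have yE t : y t = alg_act (q t) (fun j => free_gen P (c t j)) :=
  projT2 (cid (projT2 (cid (projT2 (cid (ym t)))))).
apply: QB; exists (tot J), (op_comp p q), (fun x => c (tag x) (tagged x)).
by rewrite alg_act_comp; congr alg_act; apply: funext => t; rewrite yE.
Qed.

Definition cone_span (M : rmod P) (L : algebra P) (V : lmodType k)
    (E : cone M L V) : Prop :=
  forall y, in_span (fun v => exists (T : finType) (a : T -> L) (m : M T),
    v = E T a m) y.

Lemma kahler_cone_span (L : algebra P) : cone_span (kahler_cone L).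
Proof.
move=> y Q [Q0 Ql] QE; elim/pres_ind: y => [[m p a i]||u v Qu Qv|c u Qu] //.
- by apply: QE; exists 'I_m, a, (dpair p i : Omega P _); rewrite -kgen_cone.
- by rewrite -[u]scale1r; apply: Ql.
- by rewrite -[_ *: _]addr0; apply: Ql.
Qed.

Lemma schur_cone_span (Z : species k) (L : algebra P) :
  cone_span (schur_cone Z L).
Proof.
move=> y Q [Q0 Ql] QE; elim/pres_ind: y => [[n z v]||u v Qu Qv|c u Qu] //.
- by apply: QE; exists 'I_n, v, (comp_unit P z); rewrite -sgen_cone.
- by rewrite -[u]scale1r; apply: Ql.
- by rewrite -[_ *: _]addr0; apply: Ql.
Qed.

(** [cone_act] moves the operations occurring in the arguments into the module element, which leaves
    bare generators as arguments. *)
Lemma cone_free_span (M : rmod P) (I : Type) (V : lmodType k)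
    (E : cone M (free_alg P I) V) (y : V) :
  cone_span E ->
  in_span (fun v => exists (T : finType) (c : T -> I) (m : M T),
    v = E T (fun t => free_gen P (c t)) m) y.
Proof.
move=> Es Q Ql QB; apply: Es => // _ [T [a [m ->]]].
apply: (multilinear_span (cone_multilinear E m) Ql _
  (fun t => free_span (a t))).
move=> b bm; pose J t := projT1 (cid (bm t)).
pose q t : P (J t) := projT1 (cid (projT2 (cid (bm t)))).
pose c t : J t -> I := projT1 (cid (projT2 (cid (projT2 (cid (bm t)))))).
have bE t : b t = alg_act (q t) (fun j => free_gen P (c t j)) :=
  projT2 (cid (projT2 (cid (projT2 (cid (bm t)))))).
apply: QB; exists (tot J), (fun x => c (tag x) (tagged x)), (rm_act m q).
by rewrite cone_act; congr (cone_fun E _ _); apply: funext => t; rewrite bE.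
Qed.

End ConeSpan.

(** * Separation of the eigenvalues 2^d *)

Section EigenSpan.
Variables (k : fieldType) (k_char0 : [pchar k] =i pred0).
Variables (V : lmodType k) (D : {linear V -> V}).

Lemma expr2_eq2 n : (2 ^+ n == 2 :> k) = (n == 1)%N.
Proof using k_char0.
have char0 := iffLR (pcharf0P k) k_char0.
have E m p : (p <= m)%N -> (m%:R == p%:R :> k) = (m == p).
  by move=> pm; rewrite -subr_eq0 -natrB // char0 subn_eq0 eqn_leq pm andbT.
case: n => [|n]; first by rewrite expr0 eq_sym -[1]/(1%:R) E.
by rewrite -natrX E ?(@leq_exp2l 2 1) // -{2}[2%N]expn1 eqn_exp2l.
Qed.

(* Lagrange interpolation: this product of the D - 2^d kills the eigenvectors of
   eigenvalue 2^d for d < N, d != 1, and rescales those of eigenvalue 2. *)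
Fixpoint annihilate (N : nat) (y : V) : V :=
  if N is N'.+1 then
    let z := annihilate N' y in if N' == 1%N then z else D z - 2 ^+ N' *: z
  else y.

Definition annihilate_coef (N : nat) (l : k) : k :=
  \prod_(d < N | d != 1 :> nat) (l - 2 ^+ d).

Lemma annihilate_linear N : linear (annihilate N).
Proof.
elim: N => [|N IHN] c u v //=; case: ifP => _; rewrite IHN //.
by rewrite linearP scalerDr scalerBr scalerA mulrC -scalerA opprD addrACA.
Qed.

Lemma annihilate_eigen N (l : k) (y : V) :
  D y = l *: y -> annihilate N y = annihilate_coef N l *: y.
Proof.
move=> Dy; elim: N => [|N IHN] /=.
  by rewrite /annihilate_coef big_ord0 scale1r.
have -> : annihilate_coef N.+1 l = annihilate_coef N l *
    (if N == 1%N then 1 else l - 2 ^+ N).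
  rewrite /annihilate_coef big_mkcond big_ord_recr /= -big_mkcond /=.
  by case: eqP.
rewrite IHN; case: eqP => _ /=; first by rewrite mulr1.
by rewrite linearZ /= Dy !scalerA -scalerBl mulrBr [2 ^+ N * _]mulrC.
Qed.

Lemma annihilate_coef0 N d :
  (d < N)%N -> d != 1%N -> annihilate_coef N (2 ^+ d) = 0.
Proof.
move=> dN d1; rewrite /annihilate_coef (bigD1 (Ordinal dN)) //=.
by rewrite subrr mul0r.
Qed.

Lemma annihilate_coef2_neq0 N : annihilate_coef N 2 != 0.
Proof using k_char0.
by apply/prodf_neq0 => d d1; rewrite subr_eq0 eq_sym expr2_eq2.
Qed.

Lemma in_span_lin_closed (B : V -> Prop) : lin_closed (in_span B).
Proof.
split=> [Q [Q0 _] _|c u v Bu Bv Q Ql QB] //.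
by case: (Ql) => _; apply; [apply: Bu|apply: Bv].
Qed.

(** For large [N], [annihilate N] kills the terms of [y] outside [B'] and rescales those inside,
    while it multiplies [y] itself by a nonzero scalar. *)
Lemma eigen_span (B B' : V -> Prop) (y : V) :
    (forall b, B b -> B' b \/ exists2 d, d != 1%N & D b = 2 ^+ d *: b) ->
    (forall b, B' b -> D b = 2 *: b) ->
  in_span B y -> D y = 2 *: y -> in_span B' y.
Proof using k_char0.
move=> BB' B'D yB Dy.
(* Asking for all [N'] beyond a threshold makes the property stable under sums: the larger threshold
   serves both terms. *)
have [N /(_ N (leqnn N))] :
    exists N, forall N', (N <= N')%N -> in_span B' (annihilate N' y).
  have [S0 Sl] := in_span_lin_closed B'.
  apply: (yB (fun y => exists N, forall N', (N <= N')%N ->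
    in_span B' (annihilate N' y))) => [|b /BB'[B'b|[d d1 Db]]].
  - split=> [|c u v [N uN] [N' vN]].
      by exists 0%N => N' _; rewrite (linear_zero (annihilate_linear N')).
    exists (maxn N N') => N''; rewrite geq_max => /andP[/uN u' /vN v'].
    by rewrite annihilate_linear; apply: Sl.
  - exists 0%N => N _; rewrite (annihilate_eigen _ (B'D b B'b)) -[_ *: _]addr0.
    by apply: Sl => // Q _; apply.
  - exists d.+1 => N dN.
    by rewrite (annihilate_eigen _ Db) annihilate_coef0 ?scale0r.
rewrite (annihilate_eigen _ Dy) => yN.
have [S0 Sl] := in_span_lin_closed B'.
rewrite -[y](scalerK (annihilate_coef2_neq0 N)) -[_ *: _]addr0.
exact: Sl.
Qed.

End EigenSpan.

Section MultilinearPart.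
Variables (k : fieldType) (k_char0 : [pchar k] =i pred0) (P : operad k).
Variables (M : rmod P) (I : finType) (V : lmodType k).
Variable E : cone M (free_alg P I) V.
Hypothesis Es : cone_span E.

Definition dilate (i : I) : alg_hom (free_alg P I) (free_alg P I) :=
  free_hom (fun j => if j == i then 2 *: free_gen P j else free_gen P j).

Variable D : I -> {linear V -> V}.
Hypothesis DE : forall i (T : finType) (a : T -> free_alg P I) (m : M T),
  D i (E T a m) = E T (fun t => dilate i (a t)) m.

(** Each occurrence of the generator [i] contributes one factor 2. *)
Lemma dilate_monomial i (T : finType) (c : T -> I) (m : M T) :
  D i (E T (fun t => free_gen P (c t)) m) =
  2 ^+ #|[pred t | c t == i]| *: E T (fun t => free_gen P (c t)) m.
Proof using DE.
rewrite DE -(multilinear_scale (cone_multilinear E m)).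
by congr (cone_fun E _ _); apply: funext => t; rewrite free_hom_gen.
Qed.

Lemma multilinear_part (y : V) :
  (forall i, D i y = 2 *: y) -> exists m : M I, y = E I (@free_gen k P I) m.
Proof using k_char0 Es DE.
move=> Dy; pose B (s : seq I) v := exists (T : finType) (c : T -> I) (m : M T),
  (forall i, i \in s -> #|[pred t | c t == i]| = 1%N) /\
  v = E T (fun t => free_gen P (c t)) m.
(* One generator is treated at a time: the eigenvalue condition at [i] discards the monomials in
   which [i] does not occur exactly once. *)
have S (s : seq I) : in_span (B s) y.
  elim: s => [|i s IHs].
    move=> Q Ql QB; apply: (cone_free_span y Es Ql) => _ [T [c [m ->]]].
    by apply: QB; exists T, c, m.
  apply: (eigen_span (B := B s) k_char0 _ _ IHs (Dy i))
    => _ [T [c [m [cs ->]]]].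
    have [ci|ci] := eqVneq #|[pred t | c t == i]| 1%N; [left|right].
      by exists T, c, m; split=> // j; rewrite inE => /orP[/eqP->|/cs].
    by exists #|[pred t | c t == i]| => //; apply: dilate_monomial.
  by rewrite dilate_monomial cs ?inE ?eqxx // expr1.
apply: (S (enum I) (fun v => exists m : M I, v = E I (@free_gen k P I) m))
  => [|_ [T [c [m [ci ->]]]]].
  split=> [|d u v [m ->] [m' ->]].
    by exists 0; rewrite (linear_zero (cone_linear E _)).
  by exists (d *: m + m'); rewrite cone_linear.
(* Every generator now occurs exactly once, so [c] is a bijection along which [m] is relabelled to
   an element of M(I). *)
have cP i : exists t, [pred t | c t == i] =i pred1 t.
  by apply/card1P; rewrite ci ?mem_enum.
pose d i := projT1 (cid (cP i)).
have dP i t : (c t == i) = (t == d i) := projT2 (cid (cP i)) t.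
have cK : cancel c d by move=> t; apply/esym/eqP; rewrite -dP.
have dK : cancel d c by move=> i; apply/eqP; rewrite dP.
by exists (sp_map M (Bij cK dK) m); rewrite cone_natural.
Qed.

End MultilinearPart.

(** * Multilinear parts of a natural isomorphism *)

Section FreeOfPBW.
Variables (k : fieldType) (k_char0 : [pchar k] =i pred0) (P : operad k).
Variable Z : species k.

Definition kahler_gen_lin (I : finType) :
    {linear Omega P I -> kahler (free_alg P I)} :=
  HB.pack (kahler_cone (free_alg P I) I (@free_gen k P I))
    (GRing.isLinear.Build k (Omega P I) (kahler (free_alg P I)) *:%R
       (kahler_cone (free_alg P I) I (@free_gen k P I))
       (cone_linear (kahler_cone (free_alg P I)) (@free_gen k P I))).

Definition schur_gen_lin (I : finType) :
    {linear free_rmod Z P I -> schur Z (free_alg P I)} :=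
  schur_eval Z (@free_gen k P I).

(** A retraction of [kahler_gen_lin]: the generators go to the elements [nfam_unit] of the test
    algebra, and the coefficient at the identity of [I] is read off. *)
Definition kahler_multilinear_part (I : finType) :
    {linear kahler (free_alg P I) -> Omega P I} :=
  kahler_lift (conv_cone (Omega P) (@id I)) \o
  kahler_map (@free_hom k P I (nfam_alg P I) (@nfam_unit k P I)).

Definition schur_multilinear_part (I : finType) :
    {linear schur Z (free_alg P I) -> free_rmod Z P I} :=
  schur_lift (conv_cone (free_rmod Z P) (@id I)) \o
  schur_map Z (@free_hom k P I (nfam_alg P I) (@nfam_unit k P I)).

Lemma kahler_gen_linK I :
  cancel (kahler_gen_lin I) (@kahler_multilinear_part I).
Proof.
move=> w; rewrite -[LHS]/(kahler_lift _ (kahler_map _ (kahler_cone _ _ _ w))).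
rewrite kahler_map_cone kahler_lift_cone -[RHS]conv_unit.
congr (conv _ _ _); apply: funext => i.
exact: (@free_hom_gen _ _ _ (nfam_alg P I)).
Qed.

Lemma schur_gen_linK I :
  cancel (schur_gen_lin I) (@schur_multilinear_part I).
Proof.
move=> u; rewrite -[LHS]/(schur_lift _ (schur_map _ _ (schur_cone _ _ _ _ u))).
rewrite schur_map_cone schur_lift_cone -[RHS]conv_unit.
congr (conv _ _ _); apply: funext => i.
exact: (@free_hom_gen _ _ _ (nfam_alg P I)).
Qed.

Lemma dilate_gen (M : rmod P) (I : finType) (V : lmodType k)
    (E : cone M (free_alg P I) V) (D : I -> {linear V -> V}) :
    (forall i (T : finType) (a : T -> free_alg P I) (m : M T),
       D i (E T a m) = E T (fun t => dilate P i (a t)) m) ->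
  forall i (m : M I),
    D i (E I (@free_gen k P I) m) = 2 *: E I (@free_gen k P I) m.
Proof.
move=> DE i m; rewrite (dilate_monomial DE i id).
by rewrite (eq_card1 (x := i)) ?expr1.
Qed.

Let kahler_dilate I i := @kahler_map_cone k P _ _ (@dilate k P I i).
Let schur_dilate I i := @schur_map_cone k P Z _ _ (@dilate k P I i).

Lemma PBW_freely_generated :
  kahler_PBW P Z -> freely_generated (Omega P) Z.
Proof using k_char0.
case=> alpha [alphaB alphaN].
have inv L : exists g, cancel (alpha L) g /\ cancel g (alpha L).
  by case: (alphaB L) => g; exists g.
pose beta L := projT1 (cid (inv L)).
have alphaK L : cancel (alpha L) (beta L) := proj1 (projT2 (cid (inv L))).
have betaK L : cancel (beta L) (alpha L) := proj2 (projT2 (cid (inv L))).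
have betaN (L L' : algebra P) (f : alg_hom L L') y :
    beta L' (schur_map Z f y) = kahler_map f (beta L y).
  by apply: (can_inj (alphaK L')); rewrite betaK alphaN betaK.
pose phi I : {linear Omega P I -> free_rmod Z P I} :=
  schur_multilinear_part I \o alpha (free_alg P I) \o kahler_gen_lin I.
(* By naturality [alpha] commutes with the dilations, so it maps multilinear elements to multilinear
   ones, on which [schur_multilinear_part] loses nothing. *)
have phiE I w : schur_gen_lin I (phi I w) = alpha _ (kahler_gen_lin I w).
  have [i|u yu] := multilinear_part k_char0 (@schur_cone_span k P Z _)
    (@schur_dilate I) (y := alpha _ (kahler_gen_lin I w)).
    rewrite -alphaN (dilate_gen (@kahler_dilate I)).
    exact: linearZ_LR.
  rewrite -[phi I w]/(schur_multilinear_part I (alpha _ (kahler_gen_lin I w))).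
  by rewrite yu [schur_multilinear_part _ _]schur_gen_linK.
pose psi I u := kahler_multilinear_part I (beta _ (schur_gen_lin I u)).
have psiE I u : kahler_gen_lin I (psi I u) = beta _ (schur_gen_lin I u).
  have [i|w yw] := multilinear_part k_char0 (@kahler_cone_span k P _)
    (@kahler_dilate I) (y := beta _ (schur_gen_lin I u)).
    rewrite -betaN (dilate_gen (@schur_dilate I)).
    by apply: (can_inj (alphaK _)); rewrite betaK linearZ_LR betaK.
  by rewrite /psi yw [kahler_multilinear_part _ _]kahler_gen_linK.
(* The family [a] is the image of the generators under [free_hom a], so naturality extends [phiE]
   from generators to arbitrary arguments. *)
have hom_phi (I J : finType) (a : I -> free_alg P J) (w : Omega P I) :
    alpha _ (kahler_cone _ _ a w) = schur_cone Z _ _ a (phi I w).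
  have ah : a = fun i => free_hom a (free_gen P i).
    by apply: funext => i; rewrite free_hom_gen.
  by rewrite ah -kahler_map_cone alphaN -phiE -schur_map_cone.
exists phi; split=> [I|I J s w|I J w q].
- exists (psi I) => [w|u].
    apply: (can_inj (@kahler_gen_linK I)).
    by rewrite psiE phiE alphaK.
  by apply: (can_inj (@schur_gen_linK I)); rewrite phiE psiE betaK.
- apply: (can_inj (@schur_gen_linK J)); rewrite phiE.
  rewrite -[kahler_gen_lin J _]/(kahler_cone _ _ _ _) cone_natural hom_phi.
  by rewrite -(cone_natural (schur_cone Z _)).
(* [cone_act] trades the action of [q] for arguments built from [q] and the generators, where
   [hom_phi] applies; the same rule for [schur_cone] then restores the action. *)
- apply: (can_inj (@schur_gen_linK (tot J))); rewrite phiE.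
  rewrite -[kahler_gen_lin _ _]/(kahler_cone _ _ _ _) cone_act hom_phi.
  by rewrite -(cone_act (schur_cone Z _)).
Qed.

End FreeOfPBW.

Theorem proposition1 (k : fieldType) (k_char0 : [pchar k] =i pred0)
    (P : operad k) (W : connected_weight_grading P) :
  ((exists Z : species k, kahler_PBW P Z) <->
   (exists Z : species k, freely_generated (Omega P) Z)) /\
  (forall Z : species k, freely_generated (Omega P) Z -> kahler_PBW P Z).
Proof.
split; last exact: freely_generated_PBW.
split=> -[Z HZ]; exists Z; first exact: PBW_freely_generated.
exact: freely_generated_PBW.
Qed.
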